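(* Let $n$ be a positive integer and let $t,k$ be integers with $3 \le t < k$. Write $n = q(k-2) + r$ with integers $q\ge 0$ and $1 \le r \le k-2$. If $G$ is a graph on $n$ vertices containing no cycle of length at least $k$, then $$k_t(G) \le k_t(qK_{k-1} \cup K_r) = q\binom{k-1}{t} + \binom{r}{t}.$$ Furthermore, an $n$-vertex graph $G$ with no cycle of length at least $k$ attains equality if and only if: - when $t \le r$: $G \in \mathcal{G}_{tree}(qK_{k-1}, K_r)$ (the blocks being $q$ copies of $K_{k-1}$ and one copy of $K_r$); - when $t > r$: $G \in \mathcal{G}'$, where $\mathcal{G}' = \{G : |V(G)| = n,\ G \in \mathcal{G}_{forest}(qK_{k-1}, L) \text{ for some graph } L\}$.
   Context: $k_t(G)$ denotes the number of copies of $K_t$ in $G$, and $qK_{k-1}\cup K_r$ is the vertex-disjoint union of $q$ copies of $K_{k-1}$ and one $K_r$. For connected graphs $F_1,\dots,F_l$, $\mathcal{G}_{tree}(F_1,\dots,F_l)$ (respectively $\mathcal{G}_{forest}(F_1,\dots,F_l)$) is the family of graphs $G$ such that: (1) the edge set of $G$ can be partitioned into $l$ sets $E_1,\dots,E_l$ such that the graph $G(E_i)$ formed by the edges in $E_i$ (and their endpoints) is isomorphic to $F_i$ for each $i$, and $|V(G(E_i)) \cap V(G(E_j))| \le 1$ for all $i \ne j$; and (2) the auxiliary graph $H$ on vertex set $\{1,\dots,l\}$, in which $ij \in E(H)$ iff $G(E_i)$ and $G(E_j)$ share a vertex, is a tree (respectively a forest). The graphs $F_i$ are called blocks; ''$qK_{k-1}$''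 in the argument list means $q$ blocks each equal to $K_{k-1}$. For arbitrary (possibly disconnected) graphs $F_1,\dots,F_l$, where $F_i$ has connected components $F_{i,1},\dots,F_{i,j_i}$, one defines $\mathcal{G}_{forest}(F_1,\dots,F_l) := \mathcal{G}_{forest}(F_{1,1},\dots,F_{1,j_1},F_{2,1},\dots,F_{l,j_l})$.
   Formalization: ''H is a tree/forest'' is relaxed: cycles of H whose blocks all pass through one common vertex of G are allowed. Read literally the claim fails, e.g. for three triangles sharing one vertex (k=4, t=3, q=3, r=1), which attain equality though H is a triangle. *)

(* Defs.v *)
From mathcomp Require Import all_boot.

Set Implicit Arguments.
Unset Strict Implicit.
Unset Printing Implicit Defensive.

Record sgraph := SGraph {
  svertex :> finType;
  sedge : rel svertex;
  sedge_sym : symmetric sedge;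
  sedge_irrefl : irreflexive sedge }.

Definition sgraph_iso (G H : sgraph) : Prop :=
  exists2 f : G -> H, bijective f & {mono f : x y / sedge x y}.

Definition is_cycle (G : sgraph) (c : seq G) : bool :=
  [&& 2 < size c, cycle (@sedge G) c & uniq c].

Definition sconnected (G : sgraph) : Prop :=
  0 < #|G| /\ forall x y : G, connect (@sedge G) x y.

Definition edges (G : sgraph) : {set {set G}} :=
  [set e | [exists x, exists y, sedge x y && (e == [set x; y])]].

Definition num_cliques (t : nat) (G : sgraph) : nat :=
  #|[set A : {set G} | (#|A| == t) &&
      [forall x in A, forall y in A, (x != y) ==> sedge x y]]|.

Section Complete.
Variable n : nat.

Definition complete_rel : rel 'I_n := fun i j => i != j.

Fact complete_sym : symmetric complete_rel.
Proof. by move=> i j; rewrite /complete_rel eq_sym. Qed.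

Fact complete_irrefl : irreflexive complete_rel.
Proof. by move=> i; rewrite /complete_rel eqxx. Qed.

Definition complete : sgraph := SGraph complete_sym complete_irrefl.
End Complete.

Section DisjointUnion.
Variables G H : sgraph.

Definition dunion_rel : rel (G + H)%type := fun u v =>
  match u, v with
  | inl x, inl y => sedge x y
  | inr x, inr y => sedge x y
  | _, _ => false
  end.

Fact dunion_sym : symmetric dunion_rel.
Proof. by move=> [x|x] [y|y] //=; rewrite sedge_sym. Qed.

Fact dunion_irrefl : irreflexive dunion_rel.
Proof. by move=> [x|x] /=; rewrite sedge_irrefl. Qed.

Definition dunion : sgraph := SGraph dunion_sym dunion_irrefl.
End DisjointUnion.

Section Induced.
Variables (G : sgraph) (A : {set G}).

Definition induced_rel : rel {x : G | x \in A} :=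
  fun x y => sedge (val x) (val y).

Fact induced_sym : symmetric induced_rel.
Proof. by move=> x y; rewrite /induced_rel sedge_sym. Qed.

Fact induced_irrefl : irreflexive induced_rel.
Proof. by move=> x; rewrite /induced_rel sedge_irrefl. Qed.

Definition induced : sgraph := SGraph induced_sym induced_irrefl.
End Induced.

Definition components (G : sgraph) : seq sgraph :=
  [seq induced C
     | C <- enum (equivalence_partition (connect (@sedge G)) [set: G])].

(* The graph G(E) formed by a set E of edges and their endpoints; its vertex
   set is [cover E], so it never has isolated vertices. *)
Section EdgeGraph.
Variables (T : finType) (E : {set {set T}}).

Definition edge_graph_rel : rel {x : T | x \in cover E} :=
  fun x y => (x != y) && ([set val x; val y] \in E).

Fact edge_graph_sym : symmetric edge_graph_rel.
Proof. by move=> x y; rewrite /edge_graph_rel eq_sym setUC. Qed.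

Fact edge_graph_irrefl : irreflexive edge_graph_rel.
Proof. by move=> x; rewrite /edge_graph_rel eqxx. Qed.

Definition edge_graph : sgraph := SGraph edge_graph_sym edge_graph_irrefl.
End EdgeGraph.

(* The auxiliary graph H: two blocks are adjacent when they share a vertex. *)
Section AuxGraph.
Variables (T : finType) (l : nat) (E : 'I_l -> {set {set T}}).

Definition aux_rel : rel 'I_l :=
  fun i j => (i != j) && (cover (E i) :&: cover (E j) != set0).

Fact aux_sym : symmetric aux_rel.
Proof. by move=> i j; rewrite /aux_rel eq_sym setIC. Qed.

Fact aux_irrefl : irreflexive aux_rel.
Proof. by move=> i; rewrite /aux_rel eqxx. Qed.

Definition aux_graph : sgraph := SGraph aux_sym aux_irrefl.

(* "H is a forest" must not be read as literal acyclicity of H: blocks through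
   a common vertex are pairwise adjacent in H, so three of them would already
   be excluded, although copies of K_(k-1) glued at one vertex are extremal.
   The cycles of H that are tolerated are exactly those all of whose blocks
   pass through one common vertex; when no vertex lies in three blocks this is
   literal acyclicity.  Equivalently (for blocks meeting pairwise in at most
   one vertex), the block-vertex incidence graph is a forest. *)
Definition aux_forest : Prop :=
  forall c : seq aux_graph, is_cycle c ->
    exists v : T, all (fun i => v \in cover (E i)) c.

Definition aux_tree : Prop := sconnected aux_graph /\ aux_forest.
End AuxGraph.

Definition block_decomposition (G : sgraph) (Fs : seq sgraph)
    (E : 'I_(size Fs) -> {set {set G}}) : Prop :=
  [/\ \bigcup_i E i = edges G,
      forall i j, i != j -> [disjoint E i & E j],
      forall i, sgraph_iso (edge_graph (E i)) (nth (complete 0) Fs i) &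
      forall i j, i != j -> #|cover (E i) :&: cover (E j)| <= 1].

(* Meant for lists of connected graphs. *)
Definition G_tree (Fs : seq sgraph) (G : sgraph) : Prop :=
  exists2 E, @block_decomposition G Fs E & aux_tree E.

Definition G_forest_connected (Fs : seq sgraph) (G : sgraph) : Prop :=
  exists2 E, @block_decomposition G Fs E & aux_forest E.

Definition G_forest (Fs : seq sgraph) : sgraph -> Prop :=
  G_forest_connected (flatten [seq components F | F <- Fs]).

Definition G_prime (n q k : nat) (G : sgraph) : Prop :=
  #|G| = n /\ exists L : sgraph, G_forest (rcons (nseq q (complete k.-1)) L) G.

(* Main.v *)
Require Import Defs.
From mathcomp Require Import all_boot.
From mathcomp Require Import zify.

(* Split G into blocks (maximal pieces without cut vertices); they form a
   hyperforest, so their values |B| - 1 add up to at most n - 1, and every clique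
   lies in one block.  A block with fewer than k vertices has at most
   C(|B|, t) cliques.  For a 2-connected graph on k + j vertices, contract
   repeatedly a vertex of minimum degree into a neighbour so as to stay
   2-connected, down to k vertices.  A longest path whose ends have maximal
   degree sum shows, as in Posa's theorem, that s vertices have degree at most s
   for some 2 <= s <= (k - 1) / 2; this applies at every stage.  Going back up,
   minimum degrees grow by at most one at a time, and Pascal's rule makes the
   resulting count strictly smaller than the extremal one.  By convexity of
   binomials the block bounds are superadditive, and equality forces q blocks
   K_(k-1) and, if t <= r, a single further block K_r. *)

Set Implicit Arguments.
Unset Strict Implicit.
Unset Printing Implicit Defensive.

(** * Binomial inequalities *)

(** Blocks are measured by [|B| - 1] and the graph by [n - 1], so that gluing at a vertex becomes
    addition and the extremal number becomes a superadditive function of the weight, with period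
    [k - 2]. Deleting a vertex of small degree would be simpler than contracting, but it may destroy
    2-connectedness, on which the degree condition rests; contracting a well-chosen edge keeps it
    and creates no cycle of length [k] or more. A contracted vertex of degree [d] costs at most
    [C(d, t - 1)] cliques, and [d] has two bounds: [s + i + 1], counted up from the last stage, and
    [h], the integer part of [(k - 1) / 2], from Posa's condition at its own stage. Because of the
    cap [h], any [k - 2] contractions cost no more than one further [K_(k-1)], so only the first
    period needs a delicate estimate. The split in the equality case comes from [C(r, t)]: if
    [t > r] it is zero, the blocks other than the [K_(k-1)] contain no [t]-clique and their shape
    stays free; if [t <= r] it is positive and forces them to be one clique. *)

Section Binomials.

Lemma ltn_bin2l (m n u : nat) : 0 < u <= n -> m < n -> 'C(m, u) < 'C(n, u).
Proof.
case: u n => [|u] [|n] //= un mn; rewrite binS.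
have := @leq_bin2l m n u.+1 mn; have : 0 < 'C(n, u) by rewrite bin_gt0.
lia.
Qed.

(** By Pascal's rule a unit step at [x] adds [C(x, u - 1)], which is monotone in [x]; hence [i]
    steps from [a] gain at least as much as [i] steps from [b]. *)
Lemma bin_convex (u a b i : nat) :
  b <= a -> 'C(b + i, u) + 'C(a, u) <= 'C(a + i, u) + 'C(b, u).
Proof.
move=> ba; elim: i => [|i IH]; first by rewrite !addn0 addnC.
case: u IH => [|u] IH; first by rewrite !bin0.
rewrite !addnS !binS; have := @leq_bin2l (b + i) (a + i) u; lia.
Qed.

Lemma bin_convex_lt (u a b i : nat) :
  b < a -> 0 < i -> 1 < u <= a + i ->
  'C(b + i, u) + 'C(a, u) < 'C(a + i, u) + 'C(b, u).
Proof.
case: i u => [|i] [|u] // ba _ /andP[u1 ui]; rewrite !addnS !binS.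
have := @bin_convex u.+1 a b i (ltnW ba).
have := @ltn_bin2l (b + i) (a + i) u; lia.
Qed.

(** Convexity replaces the pair [a], [b] by [a + b - 1] and [1], and [C(1, u)] vanishes because
    [u > 1]. *)
Lemma bin_superadd_lt (u a b c : nat) :
  1 < a -> 1 < b -> a + b <= c.+1 -> 1 < u <= c -> 'C(a, u) + 'C(b, u) < 'C(c, u).
Proof.
move=> a1 b1 abc /andP[u1 uc]; case: (ltnP (a + b).-1 u) => [lt_u|le_u].
  by rewrite (@bin_small a) ?(@bin_small b) ?bin_gt0; lia.
have H : 'C(1 + b.-1, u) + 'C(a, u) < 'C(a + b.-1, u) + 'C(1, u).
  by apply: bin_convex_lt; lia.
have : 'C(a + b.-1, u) <= 'C(c, u) by apply: leq_bin2l; lia.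
by move: H; rewrite (@bin_small 1) // add1n prednK; lia.
Qed.

Lemma sum_bin_diag (u n : nat) : \sum_(i < n) 'C(i, u) = 'C(n, u.+1).
Proof.
by elim: n => [|n IH]; rewrite ?big_ord0 ?bin0n // big_ord_recr /= IH binS.
Qed.

End Binomials.

(** The extremal number in terms of [m = n - 1], with [p = k - 2]: the quotient counts the copies of
    [K_(k-1)] and the remainder is [r - 1]. *)
Definition gmax (p t m : nat) := (m %/ p) * 'C(p.+1, t) + 'C((m %% p).+1, t).

Section Gmax.
Variables p t : nat.
Hypotheses (t3 : 2 < t) (tp : t <= p.+1).
Local Notation g := (gmax p t).

Let p2 : 1 < p. Proof. lia. Qed.

Lemma gmaxDp (c m : nat) : g (c * p + m) = c * 'C(p.+1, t) + g m.
Proof. by rewrite /gmax divnMDl ?modnMDl ?mulnDl ?addnA //; lia. Qed.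

(** The formula survives at [m = p]: there the quotient becomes 1 and the remainder contributes
    [C(1, t) = 0]. *)
Lemma gmax_small (m : nat) : m <= p -> g m = 'C(m.+1, t).
Proof.
rewrite leq_eqVlt => /orP[/eqP ->|mp]; last by rewrite /gmax divn_small ?modn_small.
rewrite /gmax divnn modnn; have -> : 0 < p by lia.
by rewrite (@bin_small 1) ?mul1n ?addn0 //; lia.
Qed.

(** The upper indices [a + 1], [b + 1] are replaced by a pair with the same sum and larger spread:
    [a + b + 1] and [1] within the period, [p + 1] and [a + b - p + 1] beyond it. *)
Lemma gmax_add_small (a b : nat) : a < p -> b < p -> g a + g b <= g (a + b).
Proof.
move=> ap bp; rewrite (gmax_small (ltnW ap)) (gmax_small (ltnW bp)).
have [le|lt] := leqP (a + b) p.
  rewrite gmax_small //; have := @bin_convex t a.+1 1 b isT.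
  by rewrite (@bin_small 1) ?addn0 ?add1n 1?addSn; lia.
have {1}-> : a + b = 1 * p + (a + b - p) by lia.
rewrite gmaxDp mul1n gmax_small; last lia.
have le : (a + b - p).+1 <= a.+1 by lia.
have := bin_convex t (p - a) le.
have -> : (a + b - p).+1 + (p - a) = b.+1 by lia.
have -> : a.+1 + (p - a) = p.+1 by lia.
lia.
Qed.

Lemma gmax_add (a b : nat) : g a + g b <= g (a + b).
Proof.
rewrite (divn_eq a p) (divn_eq b p) !gmaxDp.
have -> : a %/ p * p + a %% p + (b %/ p * p + b %% p) =
          (a %/ p + b %/ p) * p + (a %% p + b %% p) by lia.
rewrite gmaxDp; have := @gmax_add_small (a %% p) (b %% p).
rewrite !ltn_mod; lia.
Qed.

Lemma gmax_mono (a b : nat) : a <= b -> g a <= g b.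
Proof. move=> ab; have := gmax_add a (b - a); rewrite subnKC //; lia. Qed.

Lemma gmax_sum (I : finType) (P : pred I) (F : I -> nat) :
  \sum_(i | P i) g (F i) <= g (\sum_(i | P i) F i).
Proof.
elim/big_rec2: _ => [|i x y _ IH]; first by [].
by apply: leq_trans (gmax_add _ _); rewrite leq_add2l.
Qed.

Lemma gmax_cross_lt (a b : nat) : a < p -> b < p -> p <= a + b -> g a + g b < g (a + b).
Proof.
move=> ap bp pab; rewrite (gmax_small (ltnW ap)) (gmax_small (ltnW bp)).
have {1}-> : a + b = 1 * p + (a + b - p) by lia.
rewrite gmaxDp mul1n gmax_small; last lia.
have H : 'C((a + b - p).+1 + (p - a), t) + 'C(a.+1, t) <
         'C(a.+1 + (p - a), t) + 'C((a + b - p).+1, t) by apply: bin_convex_lt; lia.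
move: H; have -> : (a + b - p).+1 + (p - a) = b.+1 by lia.
have -> : a.+1 + (p - a) = p.+1 by lia.
lia.
Qed.

Lemma gmax_small_lt (a b : nat) :
  0 < a -> 0 < b -> a + b <= p -> t <= (a + b).+1 -> g a + g b < g (a + b).
Proof.
move=> a0 b0 abp tab; rewrite !gmax_small //; try lia.
by apply: bin_superadd_lt; lia.
Qed.

End Gmax.

(** * The degree sums of successive contractions against the extremal number *)

Section DegreeBound.
Variables k t h s : nat.
Hypotheses (t3 : 2 < t) (tk : t < k) (hk : h.*2 < k) (s2 : 1 < s) (sh : s <= h).
Local Notation gam i := 'C(i, t.-1).

Let sum_gam (n : nat) : 'C(n, t) = \sum_(i < n) gam i.
Proof. by rewrite sum_bin_diag prednK //; lia. Qed.

(** The sum of [gam (i + 1)] is added to its own reversal. Paired arguments sum to [k - 1 >= 2h], so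
    by convexity each pair is worth at least [2 gam h]. *)
Lemma period_bound : (k - 2) * gam h <= 'C(k.-1, t).
Proof.
have e1 : 'C(k.-1, t) = \sum_(i < k - 2) gam i.+1.
  have -> : k.-1 = (k - 2).+1 by lia.
  by rewrite sum_gam big_ord_recl /= bin_small ?add0n //; lia.
have e2 : 'C(k.-1, t) = \sum_(i < k - 2) gam (k - 2 - i).
  rewrite e1 (reindex_inj rev_ord_inj); apply: eq_bigr => i _ /=.
  by congr 'C(_, _); have := ltn_ord i; lia.
rewrite -leq_double -!addnn {1}e1 e2 -big_split -mulnDr -[X in X * _]card_ord -sum_nat_const.
apply: leq_sum => i _ /=; have := ltn_ord i.
have mono := @leq_bin2l; move: (nat_of_ord i) => {}i ik.
have [le|lt] := leqP i.+1 h.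
  have := @bin_convex t.-1 h i.+1 (h - i.+1) le.
  have := mono (h + (h - i.+1)) (k - 2 - i) t.-1.
  rewrite subnKC //; lia.
have := mono h i.+1 t.-1; case: (leqP h (k - 2 - i)) => [le2|lt2].
  have := mono h (k - 2 - i) t.-1; lia.
have := @bin_convex t.-1 h (k - 2 - i) (h - (k - 2 - i)).
have := mono (h + (h - (k - 2 - i))) i.+1 t.-1.
have -> : k - 2 - i + (h - (k - 2 - i)) = h by lia.
lia.
Qed.

(** Convexity moves [h], [s] apart to [h + i + 1], [s - i - 1], and [h + i + 1 <= k - s + i] since
    [s + h < k]. Strictness comes from the last index [i = s - 2], where [gam (k - 2)] alone exceeds
    [gam s + gam h]. *)
Lemma gap_bound :
  s.-1 * (gam s + gam h) < \sum_(i < s.-1) (gam (k - s + i) + gam (s - i.+1)).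
Proof.
have [r rE] : exists r, s = r.+2 by exists (s - 2); lia.
have term (i : nat) : i < r.+1 ->
    gam s + gam h <= gam (k - s + i) + gam (s - i.+1).
  move=> ir; have := @bin_convex t.-1 h (s - i.+1) i.+1.
  have -> : s - i.+1 + i.+1 = s by lia.
  have := @leq_bin2l (h + i.+1) (k - s + i) t.-1; lia.
rewrite rE /= -rE big_ord_recr /= mulSnr.
rewrite -{1}(card_ord r) -sum_nat_const -addnS; apply: leq_add.
  by apply: leq_sum => i _; apply: term; rewrite ltnS ltnW.
have := @bin_superadd_lt t.-1 s h (k - s + r); lia.
Qed.

(** Of the degree sum, [j + 2] terms fit under [C(j + 2, t)] and [s - 1] terms of size at most
    [gam h] are left over, next to [s - 1] copies of [gam s]. These are what [gap_bound] pays for,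
    out of the surplus of [C(k - 1, t)] over [C(k - s, t)]. *)
Lemma degree_bound_small (j : nat) : j < k - 2 ->
  'C(k - s, t) + s * gam s + \sum_(i < j) gam (minn (s + i.+1) h) <
  'C(k.-1, t) + 'C(j.+2, t).
Proof.
move=> jk.
have tel (m n : nat) : m <= n -> 'C(n, t) = 'C(m, t) + \sum_(i < n - m) gam (m + i).
  by move=> mn; rewrite -{1}(subnKC mn) !sum_gam big_split_ord.
have e1 : 'C(k.-1, t) = 'C(k - s, t) + \sum_(i < s.-1) gam (k - s + i).
  have ks : k - s <= k.-1 by lia.
  have E : k.-1 - (k - s) = s.-1 by lia.
  by rewrite (tel _ _ ks) E.
(* Both sides below are sums over the indices 0, ..., s + j. *)
have e2 : \sum_(i < s.+1) gam i + \sum_(i < j) gam (minn (s + i.+1) h) <=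
          \sum_(i < j.+2) gam i + s.-1 * gam h.
  have -> : \sum_(i < s.+1) gam i = \sum_(i < s.+1) gam (minn i h).
    by apply: eq_bigr => i _; rewrite (minn_idPl _) //; have := ltn_ord i; lia.
  have -> : \sum_(i < j) gam (minn (s + i.+1) h) = \sum_(i < j) gam (minn (s.+1 + i) h).
    by apply: eq_bigr => i _; rewrite addnS.
  have -> : \sum_(i < s.+1) gam (minn i h) + \sum_(i < j) gam (minn (s.+1 + i) h) =
            \sum_(i < s.+1 + j) gam (minn i h) by rewrite big_split_ord.
  have E : s.+1 + j = j.+2 + s.-1 by lia.
  rewrite E big_split_ord /= leq_add //.
    by apply: leq_sum => i _; apply: leq_bin2l; rewrite geq_minl.
  rewrite -[X in X * _]card_ord -sum_nat_const.
  by apply: leq_sum => i _; apply: leq_bin2l; rewrite geq_minr.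
have e3 : \sum_(i < s.+1) gam i = gam s + \sum_(i < s.-1) gam (s - i.+1).
  rewrite big_ord_recr /= addnC; congr addn.
  have -> : \sum_(i < s) gam i = \sum_(i < s) gam (s - i.+1).
    by rewrite (reindex_inj rev_ord_inj).
  case: s s2 => [//|r] _; rewrite big_ord_recr /= subnn.
  by rewrite [X in _ + X]bin_small ?addn0 //; lia.
have := gap_bound; rewrite big_split /=.
rewrite e3 -sum_gam in e2; rewrite e1.
move: e2; set X := \sum_(i < j) _; set Y := \sum_(i < s.-1) _; set Z := \sum_(i < s.-1) _.
have -> : s * gam s = s.-1 * gam s + gam s by rewrite -mulSnr prednK //; lia.
rewrite mulnDr {e1 e3 tel}.
move: X Y Z 'C(k - s, t) 'C(j.+2, t) (s.-1 * gam s) (s.-1 * gam h) (gam s).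
by clear; lia.
Qed.

(** For [|V| = k + j] the left side is the bound produced by [j] contractions and [k - 1 + j] is
    [|V| - 1]. The induction goes in steps of [k - 2], one period of [gmax]; [period_bound] pays for
    each step. *)
Lemma degree_bound (j : nat) :
  'C(k - s, t) + s * gam s + \sum_(i < j) gam (minn (s + i.+1) h) <
  gmax (k - 2) t (k.-1 + j).
Proof.
have kE : (k - 2).+1 = k.-1 by lia.
elim/ltn_ind: j => j IH; have [lt|le] := ltnP j (k - 2).
  have -> : k.-1 + j = 1 * (k - 2) + j.+1 by lia.
  rewrite gmaxDp ?gmax_small ?kE ?mul1n; try lia.
  exact: degree_bound_small.
have [i jE] : exists i, j = i + (k - 2) by exists (j - (k - 2)); lia.
rewrite {}jE in IH le *.
have -> : k.-1 + (i + (k - 2)) = 1 * (k - 2) + (k.-1 + i) by lia.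
rewrite gmaxDp ?kE ?mul1n; try lia.
have lt : i < i + (k - 2) by lia.
have := IH _ lt; have := period_bound; rewrite big_split_ord /=.
have : \sum_(i0 < k - 2) gam (minn (s + (i + i0).+1) h) <= (k - 2) * gam h.
  rewrite -[X in X * _]card_ord -sum_nat_const.
  by apply: leq_sum => i0 _; apply: leq_bin2l; rewrite geq_minr.
set A := \sum_(i0 < k - 2) _; set B := \sum_(i0 < i) _.
by move: A B ((k - 2) * gam h) (s * gam s) (gmax _ _ _); clear; lia.
Qed.

End DegreeBound.

(** * Block decompositions *)

Section RelationGraph.
Variable T : finType.
Implicit Types (e : rel T) (V A B X : {set T}) (F S : {set {set T}}).

Definition res e V : rel T := fun x y => [&& x \in V, y \in V & e x y].

Definition conn e V : Prop := {in V &, forall x y, connect (res e V) x y}.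

(** Single edges qualify, so bridges are blocks too; [X = set0] gives connectedness. *)
Definition twoconn e V : Prop := forall X, #|X| <= 1 -> conn e (V :\: X).

Definition clique e A : bool := [forall x in A, forall y in A, (x != y) ==> e x y].

Definition cliques e t V : {set {set T}} :=
  [set A : {set T} | [&& A \subset V, #|A| == t & clique e A]].

Definition deg e V x : nat := #|[set y in V | e x y]|.

Definition no_long_cycle e k V : Prop :=
  forall c : seq T, {subset c <= V} -> 2 < size c -> cycle e c -> uniq c -> size c < k.

(* The blocks in [F] are the hyperedges of a Berge-acyclic hypergraph. *)
Definition hyperforest F : Prop :=
  forall S, S \subset F -> S != set0 -> \sum_(B in S) #|B|.-1 < #|cover S|.

Lemma cliqueP e A : reflect {in A &, forall x y, x != y -> e x y} (clique e A).
Proof.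
apply: (iffP forall_inP) => [H x y xA yA xy|H x xA].
  by have /forall_inP/(_ y yA)/implyP := H x xA; apply.
by apply/forall_inP => y yA; apply/implyP; exact: H.
Qed.

Lemma cliqueS e A B : A \subset B -> clique e B -> clique e A.
Proof.
by move=> /subsetP AB /cliqueP H; apply/cliqueP => x y /AB xB /AB; exact: H.
Qed.

Lemma connect_mono (r1 r2 : rel T) : subrel r1 r2 -> subrel (connect r1) (connect r2).
Proof. by move=> r12; apply: connect_sub => x y /r12; exact: connect1. Qed.

Lemma connect_closed (r : rel T) A :
  {in A, forall x y, r x y -> y \in A} -> {in A, forall x y, connect r x y -> y \in A}.
Proof.
move=> clA x xA y /connectP[p + ->] {y}; elim: p x xA => [|y p IH] x xA //=.
by move=> /andP[/(clA _ xA) yA]; exact: IH.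
Qed.

Lemma res_sym e V : symmetric e -> symmetric (res e V).
Proof. by move=> sym_e x y; rewrite /res sym_e andbCA. Qed.

Lemma conn_exit e V A : conn e V -> A \subset V -> A != set0 -> A != V ->
  exists x y, [/\ x \in A, y \in V, y \notin A & e x y].
Proof.
move=> cV sAV /set0Pn[a aA] AV.
have /subsetPn[b bV bA] : ~~ (V \subset A).
  by apply: contraNN AV => sVA; rewrite eqEsubset sAV.
have [/existsP[x /existsP[y /and4P[xA yV yA exy]]]|no] := boolP
    [exists x, exists y, [&& x \in A, y \in V, y \notin A & e x y]].
  by exists x, y.
case/negP: bA; apply: (connect_closed _ aA) (cV a b (subsetP sAV _ aA) bV).
move=> x xA y /and3P[_ yV exy]; apply: contraNT no => yA.
by apply/existsP; exists x; apply/existsP; exists y; rewrite xA yV yA.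
Qed.

Section Blocks.
Variable e : rel T.

Lemma not_twoconn V : ~ twoconn e V ->
  exists X y z, [/\ #|X| <= 1, y \in V :\: X, z \in V :\: X &
                    ~~ connect (res e (V :\: X)) y z].
Proof.
move=> ntw; have [/existsP[X /existsP[y /existsP[z /and4P[]]]]|no] := boolP
  [exists X : {set T}, exists y, exists z, [&& #|X| <= 1, y \in V :\: X, z \in V :\: X &
     ~~ connect (res e (V :\: X)) y z]]; first by exists X, y, z.
case: ntw => X X1 y z yV zV; apply: contraNT no => nc.
by apply/existsP; exists X; apply/existsP; exists y; apply/existsP; exists z; apply/and4P.
Qed.

(** [C] is one component left by the cut [X]. A clique that meets [C] can leave it only into [X],
    hence lies in [C] together with [X]; every other clique avoids [C]. *)
Lemma block_split V : ~ twoconn e V -> exists V1 V2,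
  [/\ V1 \proper V, V2 \proper V, #|V1 :&: V2| <= 1 &
      forall A, A \subset V -> clique e A -> (A \subset V1) || (A \subset V2)].
Proof.
case/not_twoconn => X [y [z [X1 yV zV nyz]]].
pose C := [set u in V :\: X | connect (res e (V :\: X)) y u].
have CV : C \subset V by apply/subsetP => u; rewrite !inE => /andP[/andP[]].
have yC : y \in C by rewrite inE yV connect0.
have zC : z \notin C by rewrite inE negb_and nyz orbT.
have yV' : y \in V by move: yV; rewrite inE => /andP[].
have [zX zV'] : z \notin X /\ z \in V by move: zV; rewrite inE => /andP[].
exists (C :|: (X :&: V)), (V :\: C); split.
- rewrite properE subUset CV subsetIr; apply/subsetPn; exists z => //.
  by rewrite in_setU in_setI (negPf zC) (negPf zX).
- rewrite properE subsetDl; apply/subsetPn; exists y => //.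
  by rewrite inE yC.
- apply: leq_trans X1; apply: subset_leq_card; apply/subsetP => u.
  rewrite in_setI in_setU in_setD in_setI.
  by case: (u \in C) => //= /andP[/andP[->]].
move=> A AV /cliqueP cA; have [/subsetP|] := boolP (A \subset V :\: C); first by rewrite orbT.
rewrite orbF => /subsetPn[u uA]; rewrite in_setD (subsetP AV) // andbT negbK => uC.
apply/subsetP => w wA; have wV := subsetP AV w wA.
rewrite in_setU in_setI wV andbT; have [|wX] := boolP (w \in X); first by rewrite orbT.
have [<-|uw] := eqVneq u w; first by rewrite uC.
move: (uC); rewrite !inE => /andP[uVX yu]; rewrite wX wV /= orbF.
by apply: connect_trans yu (connect1 _); apply/and3P; rewrite !inE wX wV /=; split=> //; apply: cA.
Qed.

Lemma cover_subset F V : (forall B, B \in F -> B \subset V) -> cover F \subset V.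
Proof. by move=> H; apply/bigcupsP. Qed.

(** The two parts of a subfamily each have a vertex to spare, and their covers share at most one
    vertex, so one vertex to spare remains. *)
Lemma hyperforestU F1 F2 V1 V2 :
  hyperforest F1 -> hyperforest F2 -> #|V1 :&: V2| <= 1 ->
  {in F1, forall B : {set T}, B \subset V1} -> {in F2, forall B : {set T}, B \subset V2} ->
  hyperforest (F1 :|: F2).
Proof.
move=> h1 h2 V12 s1 s2 S SF S0.
rewrite (bigID (mem F1)) /=; set a := \sum_(_ in _ | _) _; set b := \sum_(_ in _ | _) _.
have aE : a = \sum_(B in S :&: F1) #|B|.-1 by apply: eq_bigl => B; rewrite inE.
have bE : b = \sum_(B in S :\: F1) #|B|.-1 by apply: eq_bigl => B; rewrite inE andbC.
have cS : cover S = cover (S :&: F1) :|: cover (S :\: F1).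
  by rewrite /cover -bigcup_setU setID.
have SF2 : S :\: F1 \subset F2.
  apply/subsetP => B; rewrite inE => /andP[B1 /(subsetP SF)].
  by rewrite inE (negPf B1).
have [E1|N1] := eqVneq (S :&: F1) set0.
  have E2 : S :\: F1 = S by rewrite -{2}(setID S F1) E1 set0U.
  by rewrite aE E1 big_set0 add0n bE E2; apply: h2 => //; rewrite -E2.
have [E2|N2] := eqVneq (S :\: F1) set0.
  have E1 : S :&: F1 = S by rewrite -{2}(setID S F1) E2 setU0.
  by rewrite bE E2 big_set0 addn0 aE E1; apply: h1 => //; rewrite -E1 subsetIr.
have := h1 _ (subsetIr S F1) N1; have := h2 _ SF2 N2; rewrite -aE -bE cS cardsU.
have : #|cover (S :&: F1) :&: cover (S :\: F1)| <= #|V1 :&: V2|.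
  apply/subset_leq_card/setISS; apply: cover_subset => B.
    by rewrite inE => /andP[_ /s1].
  by move=> /(subsetP SF2)/s2.
lia.
Qed.

(** The last clause serves twice: for [t]-cliques in the count, and for single edges when the blocks
    have to partition the edge set. *)
Lemma exists_blocks V : exists F,
  [/\ {in F, forall B, [/\ B \subset V, 1 < #|B| & twoconn e B]},
      hyperforest F &
      forall A, A \subset V -> 1 < #|A| -> clique e A -> exists2 B, B \in F & A \subset B].
Proof.
have [n] := ubnP #|V|; elim: n V => [//|n IH] V; rewrite ltnS => Vn.
have [tw|] := boolP [forall X : {set T}, (#|X| <= 1) ==>
  [forall x in V :\: X, forall y in V :\: X, connect (res e (V :\: X)) x y]]; last first.
  move=> ntw; have /block_split[V1 [V2 [p1 p2 V12 cl]]] : ~ twoconn e V.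
    move=> tw; case/negP: ntw; apply/forallP => X; apply/implyP => X1.
    by apply/forall_inP => x xV; apply/forall_inP => y yV; exact: tw.
  have [F1 [s1 h1 c1]] := IH V1 (leq_trans (proper_card p1) Vn).
  have [F2 [s2 h2 c2]] := IH V2 (leq_trans (proper_card p2) Vn).
  exists (F1 :|: F2); split.
  - move=> B; rewrite inE => /orP[/s1|/s2] [BV B1 tB]; split=> //.
      exact: subset_trans BV (proper_sub p1).
    exact: subset_trans BV (proper_sub p2).
  - by apply: (hyperforestU h1 h2 V12) => B /[dup] => [/s1|/s2] [].
  - move=> A AV A1 cA; case/orP: (cl A AV cA) => AV'.
      by have [B BF AB] := c1 A AV' A1 cA; exists B => //; rewrite inE BF.
    by have [B BF AB] := c2 A AV' A1 cA; exists B => //; rewrite inE BF orbT.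
have {}tw : twoconn e V.
  move=> X X1 x y xV yV; have /forallP/(_ X)/implyP/(_ X1) := tw.
  by move=> /forall_inP/(_ x xV)/forall_inP/(_ y yV).
have [V1|V1] := leqP #|V| 1.
  exists set0; split=> [B||A AV A1]; first by rewrite inE.
    by move=> S; rewrite subset0 => /eqP ->; rewrite eqxx.
  by have := subset_leq_card AV; lia.
exists [set V]; split.
- by move=> B; rewrite inE => /eqP ->.
- move=> S; rewrite subset1 => /orP[] /eqP -> S0; last by rewrite eqxx in S0.
  by rewrite big_set1 /cover big_set1 ltn_predL ltnW.
by move=> A AV _ _; exists V => //; rewrite inE.
Qed.

End Blocks.
End RelationGraph.

(** * Longest paths in 2-connected graphs *)

Section Paths.
Variables (T : finType) (e : rel T).
Hypotheses (sym_e : symmetric e) (irr_e : irreflexive e).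
Implicit Types (V A B : {set T}) (u v w x y z a b : T).

(** Only a lower bound [n] on the number of vertices is kept: bounds add up under joins, and closing
    a cycle asks for no more. *)
Definition spath A u v n : Prop := exists s,
  [/\ path e u s, last u s = v, uniq (u :: s), {subset u :: s <= A} & n <= size (u :: s)].

Lemma spath_refl A u : u \in A -> spath A u u 1.
Proof. by move=> uA; exists [::]; split=> // x; rewrite inE => /eqP ->. Qed.

Lemma spath_edge u v : e u v -> spath [set u; v] u v 2.
Proof.
move=> euv; exists [:: v]; split=> //=; first by rewrite euv.
  by rewrite inE andbT; apply: contraTneq euv => ->; rewrite irr_e.
by move=> x; rewrite !inE.
Qed.

Lemma spathW A A' u v n n' : A \subset A' -> n' <= n -> spath A u v n -> spath A' u v n'.
Proof.
move=> /subsetP AA' nn' [s [ps ls us sA sn]]; exists s; split=> //.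
  by move=> x /sA/AA'.
exact: leq_trans sn.
Qed.

Lemma spath_sym A u v n : spath A u v n -> spath A v u n.
Proof.
move=> [s [ps <- us sA sn]]; exists (rev (belast u s)).
have E : last u s :: rev (belast u s) = rev (u :: s) by rewrite (lastI u s) rev_rcons.
split.
- by rewrite rev_path; apply: sub_path ps => x y; rewrite sym_e.
- by case: (s) => [|y s'] //=; rewrite rev_cons last_rcons.
- by rewrite E rev_uniq.
- by move=> x; rewrite E mem_rev => /sA.
by rewrite E size_rev.
Qed.

Lemma spath_join A B u v w n m :
  spath A u v n -> spath B v w m -> A :&: B \subset [set v] ->
  spath (A :|: B) u w (n + m).-1.
Proof.
move=> [s [ps ls us sA sn]] [s' [ps' ls' us' sB sm]] /subsetP AB.
exists (s ++ s'); split.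
- by rewrite cat_path ps ls.
- by rewrite last_cat ls.
- move: us'; rewrite -cat_cons cat_uniq us cons_uniq => /andP[vs' ->]; rewrite andbT /=.
  apply/hasPn => x xs' /=; apply: contra vs' => xs.
  have : x \in A :&: B by rewrite inE sA ?sB // inE xs' orbT.
  by move=> /AB; rewrite inE => /eqP <-.
- move=> x; rewrite -cat_cons mem_cat in_setU => /orP[/sA -> //|xs'].
  by rewrite sB ?orbT // inE xs' orbT.
by move: sn sm; rewrite /= size_cat; lia.
Qed.

Lemma spath_cycle V A u w n k : no_long_cycle e k V -> A \subset V ->
  spath A u w n -> e w u -> 2 < n -> n < k.
Proof.
move=> nlc /subsetP AV [s [ps ls us sA sn]] ewu n2.
apply: (leq_ltn_trans sn (nlc _ _ _ _ us)); first by move=> x /sA/AV.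
  exact: leq_trans n2 sn.
by rewrite /cycle rcons_path ps ls.
Qed.

(** The path must visit all of [A], so the closing edge makes it a Hamiltonian cycle of [A], which
    can be opened at [v]. *)
Lemma spath_rot A u w n v : spath A u w n -> #|A| <= n -> e w u -> v \in A ->
  exists w', spath A v w' n.
Proof.
move=> [s [ps ls us sA sn]] An ewu vA.
have AE : [set x in u :: s] = A.
  apply/eqP; rewrite eqEcard; apply/andP; split.
    by apply/subsetP => x; rewrite in_set => /sA.
  rewrite cardsE (card_uniqP us) (leq_trans An) //.
have vs : v \in u :: s by rewrite -AE in_set in vA.
have [i s' rE] := rot_to vs.
have : cycle e (rot i (u :: s)) by rewrite rot_cycle /cycle rcons_path ps ls.
rewrite rE /cycle rcons_path => /andP[ps' _].
exists (last v s'), s'; split=> //; rewrite -rE ?rot_uniq ?size_rot //.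
by move=> x; rewrite mem_rot => /sA.
Qed.

Lemma spath_prefix a p z : path e a p -> uniq (a :: p) -> z \in a :: p ->
  spath [set x in a :: p] a z 1.
Proof.
move=> pp up; rewrite inE => /predU1P[->|].
  by apply: spath_refl; rewrite !inE eqxx.
move=> zp; case/splitPr: zp pp up => p1 p2 pp up; exists (rcons p1 z).
have E : p1 ++ z :: p2 = rcons p1 z ++ p2 by rewrite cat_rcons.
move: pp up; rewrite E cat_path => /andP[pp _]; rewrite -cat_cons cat_uniq => /andP[up _].
split=> //; first by rewrite last_rcons.
by move=> x xp; rewrite in_set mem_cat xp.
Qed.

(** A piece with a root: from whichever other vertex it is entered, at least [m] of its vertices can
    be collected on the way to the root. *)
Definition good A a m : Prop :=
  a \in A /\ forall u, u \in A -> u != a -> spath A u a m.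

(* The piece [A] is enlarged vertex by vertex, moving its root along [P], until
   an edge from [A] to [B] that avoids [P] closes a cycle. *)
Lemma good_link k V B b m m' b' : no_long_cycle e k V -> twoconn e V ->
  1 < m -> 1 < m' -> B \subset V -> good B b m' -> b' \in B -> b' != b ->
  forall A a P u,
    A \subset V -> good A a m -> u \in A -> u != a ->
    path e a P -> last a P = b -> uniq (a :: P) -> {subset P <= V} ->
    (forall x, x \in P -> x \notin A) ->
    (forall x, x \in B -> (x \in A) || (x \in P) -> x = b) ->
  m + m' <= k.
Proof.
move=> nlc tw m2 m'2 BV [bB gB] b'B b'b A.
have [n] := ubnP #|V :\: A|; elim: n A => [//|n IH] A; rewrite ltnS => An.
move=> a P u AV [aA gA] uA ua pP lP uP PV PA BAP.
have b'A : b' \notin A.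
  by apply: contraNN b'b => b'A; apply/eqP/BAP; rewrite ?b'A.
have cVa : conn e (V :\ a) by apply: tw; rewrite cards1.
(* Removing the root keeps [V] connected, so some edge leaves [A] from a vertex [x] other than
   [a]. *)
have [|||x [y [xA yV yA exy]]] := conn_exit cVa (A := A :\ a).
- exact: setSD.
- by apply/set0Pn; exists u; rewrite !inE ua.
- apply: contraNneq b'A => E; suff : b' \in A :\ a by rewrite inE => /andP[].
  rewrite E !inE (subsetP BV) // andbT; apply: contraNneq b'b => b'a.
  by apply/eqP/BAP; rewrite // b'a aA.
move: xA yV yA; rewrite !inE => /andP[xa xA] /andP[ya yV]; rewrite ya /= => yA.
have PAa : A :&: [set z in a :: P] \subset [set a].
  apply/subsetP => z; rewrite !inE => /andP[zA /orP[//|/PA]].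
  by rewrite zA.
have smaller A' : y \in A' -> A \subset A' -> #|V :\: A'| < n.
  move=> yA' AA'; apply: leq_trans An; apply/proper_card.
  rewrite properE setDS //; apply/subsetPn; exists y; rewrite !inE ?yA ?yA' //.
(* If [y] lies in [B], a cycle runs from [x] through [A] to [a], along [P] to [b], through [B] to
   [y] and back to [x]. It has at least [m + m' - 1] vertices. *)
have [yB|yB] := boolP ((y \in B) && (y != b)).
  case/andP: yB => yB yb.
  have pab : spath [set z in a :: P] a b 1.
    by apply: spath_prefix => //; rewrite -lP mem_last.
  have p1 := spath_join (gA x xA xa) pab PAa.
  have p2 := spath_join p1 (spath_sym (gB y yB yb)).
  rewrite addn1 /= in p1 p2.
  suff lt : (m + m').-1 < k by move: lt m2; clear; lia.
  apply: (spath_cycle nlc _ (p2 _) _ _).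
  - rewrite !subUset AV BV andbT /=.
    apply/subsetP => z; rewrite in_set inE => /predU1P[->|/PV //].
    exact: (subsetP AV).
  - apply/subsetP => z; rewrite !inE => /andP[zAP zB]; apply/eqP/BAP => //.
    by case/or3P: zAP => [-> //|/eqP ->|->]; rewrite ?aA ?orbT.
  - by rewrite sym_e.
  by move: m2 m'2; clear; lia.
(* If [y] lies on [P], it becomes the new root. Old vertices other than [a] continue from [a] along
   [P]; [a] and the absorbed part of [P] go back to [a], through [A] to [x], and over the edge
   [x y]. *)
have [yP|yP] := boolP (y \in P).
  case/splitPr: yP pP lP uP PV PA BAP {PAa} => P1 P2 pP lP uP PV PA BAP.
  pose A' := A :|: [set z in rcons P1 y].
  have AA' : A \subset A' by apply: subsetUl.
  have yA' : y \in A' by rewrite !inE mem_rcons mem_head orbT.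
  have E : P1 ++ y :: P2 = rcons P1 y ++ P2 by rewrite cat_rcons.
  have [pP1 pP2] : path e a (rcons P1 y) /\ path e y P2.
    by move: pP; rewrite E cat_path last_rcons => /andP.
  have uP1 : uniq (a :: rcons P1 y).
    by move: uP; rewrite E -cat_cons cat_uniq => /andP[].
  have uP2 : uniq (y :: P2) by move: uP; rewrite -cat_cons cat_uniq => /and3P[].
  have P1A z : z \in rcons P1 y -> z \notin A.
    by move=> zP; apply: PA; rewrite E mem_cat zP.
  have disj z : z \in P2 -> z \notin rcons P1 y.
    move: uP; rewrite E -cat_cons cat_uniq => /and3P[_ /hasPn H _] /H.
    by rewrite inE negb_or => /andP[].
  apply: (IH A' _ y P2 u) => //.
  - exact: smaller.
  - rewrite subUset AV; apply/subsetP => z; rewrite in_set => zP.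
    by apply: PV; rewrite E mem_cat zP.
  - split=> // z zA' zy.
    have pay : spath [set w in a :: rcons P1 y] a y 1.
      by apply: spath_prefix; rewrite // inE mem_rcons mem_head orbT.
    have AP1 : A :&: [set w in a :: rcons P1 y] \subset [set a].
      apply/subsetP => w; rewrite !inE => /andP[wA /orP[//|/P1A]].
      by rewrite wA.
    have [/andP[zA za]|] := boolP ((z \in A) && (z != a)).
      apply: spathW (spath_join (gA z zA za) pay AP1); rewrite ?addn1 //.
      apply/subsetP => w; rewrite !inE => /or3P[->//|/eqP ->|->]; rewrite ?aA ?orbT //.
    move=> nz; have zP1 : z \in a :: P1.
      move: zA'; rewrite !inE mem_rcons inE (negPf zy) /=.
      case/orP=> [zA|->]; last by rewrite orbT.
      by move: nz; rewrite zA negbK => ->.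
    have [pP1' uP1'] : path e a P1 /\ uniq (a :: P1).
      move: pP1 uP1; rewrite rcons_path -rcons_cons rcons_uniq.
      by move=> /andP[-> _] /andP[].
    have pza := spath_sym (spath_prefix pP1' uP1' zP1).
    have p1 : spath _ z x _ := spath_join pza (spath_sym (gA x xA xa)) _.
    have sub1 : [set w in a :: P1] :&: A \subset [set a].
      apply/subsetP => w; rewrite !inE => /andP[/orP[//|wP] wA].
      have : w \notin A by apply: P1A; rewrite mem_rcons inE wP orbT.
      by rewrite wA.
    have p2 := spath_join (p1 sub1) (spath_edge exy).
    apply: spathW (p2 _); last 2 first.
    + by rewrite add1n addn2 /=.
    + apply/subsetP => w; rewrite !inE => /andP[wAP /orP[//|/eqP wy]].
      move: wAP; rewrite wy (negPf ya) (negPf yA) orbF /= => yP1.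
      by move: uP1; rewrite -rcons_cons rcons_uniq inE yP1 orbT.
    apply/subsetP => w; rewrite !inE mem_rcons inE.
    by case/orP => [/orP[/orP[/eqP->|->]|->]|/orP[]/eqP->]; rewrite ?aA ?xA ?eqxx ?orbT.
  - by rewrite (subsetP AA').
  - by apply: contraNneq yA => <-.
  - by move: lP; rewrite last_cat.
  - by move=> z zP; apply: PV; rewrite mem_cat inE zP !orbT.
  - move=> z zP; rewrite !inE negb_or disj // andbT.
    by apply: PA; rewrite mem_cat inE zP !orbT.
  move=> z zB; rewrite !inE => zAP; apply: BAP => //.
  by rewrite E mem_cat; move: zAP; rewrite -orbA.
have yb : y != b.
  by apply: contraNneq yP => yb; move: (mem_last a P); rewrite lP -yb inE (negPf ya).
move: yB; rewrite yb andbT => yB.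
(* Otherwise [y] simply joins [A] under the same root: its path starts with the edge to [x]. *)
apply: (IH (y |: A) _ a P u) => //.
- by apply: smaller; rewrite ?setU11 ?subsetUr.
- by rewrite subUset sub1set yV.
- split=> [|z]; first by rewrite inE aA orbT.
  rewrite in_setU1 => /predU1P[-> _|zA za]; last exact: spathW (subsetUr _ _) _ (gA z zA za).
  have p1 := spath_join (spath_edge (u := y) (v := x) _) (gA x xA xa) _.
  apply: spathW (p1 _ _); rewrite ?(sym_e y) //.
  + by apply/subsetP => w; rewrite !inE => /orP[/orP[->|/eqP->]|->]; rewrite ?xA ?orbT.
  by apply/subsetP => w; rewrite !inE => /andP[/orP[/eqP ->|//]]; rewrite (negPf yA).
- by rewrite inE uA orbT.
- move=> z zP; rewrite !inE negb_or PA // andbT.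
  by apply: contraNneq yP => <-.
by move=> z zB; rewrite !inE => /orP[/predU1P[zy|zA]|zP]; [rewrite -zy zB in yB | |]; apply: BAP; rewrite ?zA ?zP ?orbT.
Qed.

End Paths.

Lemma card_ord_itv (N a b : nat) (S : {set 'I_N}) :
  (forall i, i \in S -> a <= i < b) -> #|S| <= b - a.
Proof.
move=> H; rewrite cardE -(size_map val) -(size_iota a (b - a)).
apply: uniq_leq_size; first by rewrite (map_inj_uniq val_inj) enum_uniq.
move=> _ /mapP[i iS ->]; rewrite mem_enum in iS; rewrite mem_iota.
have := H i iS => /=; lia.
Qed.

Section LongestPaths.
Variables (T : finType) (e : rel T).
Hypotheses (sym_e : symmetric e) (irr_e : irreflexive e).
Implicit Types (V A B : {set T}) (u v w y z a b : T) (x : nat -> T).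

(** Paths as functions of an index, meaningful below [N] only; reversal, segments and rotations
    become index arithmetic. *)
Definition npath V x N : Prop :=
  [/\ forall i, i < N -> x i \in V,
      forall i j, i < N -> j < N -> x i = x j -> i = j &
      forall i, i.+1 < N -> e (x i) (x i.+1)].

Definition seg x i j : {set T} := [set x l | l : 'I_j.+1 & i <= l].

Lemma segP x i j y : reflect (exists2 l, i <= l <= j & y = x l) (y \in seg x i j).
Proof.
apply: (iffP imsetP) => [[l il ->]|[l /andP[il lj] ->]].
  by exists (l : nat) => //; rewrite inE in il; have := ltn_ord l; lia.
by exists (Ordinal (lj : l < j.+1)); rewrite ?inE.
Qed.

Lemma mem_seg x i j l : i <= l <= j -> x l \in seg x i j.
Proof. by move=> ilj; apply/segP; exists l. Qed.

Lemma card_seg x i j : #|seg x i j| <= j.+1 - i.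
Proof.
apply: leq_trans (leq_imset_card _ _) _; rewrite -cardsE.
by apply: card_ord_itv => l; rewrite !inE => il; have := ltn_ord l; lia.
Qed.

Lemma npath_rev V x N : npath V x N -> npath V (fun i => x (N.-1 - i)) N.
Proof.
move=> [xV xI xe]; split=> [i iN|i j iN jN /xI|i iN]; first by apply: xV; lia.
  by move=> H; have := H _ _; lia.
rewrite sym_e; have := xe (N.-1 - i.+1).
by rewrite (_ : (N.-1 - i.+1).+1 = N.-1 - i); [apply|]; lia.
Qed.

Lemma npath_neq V x N i j : npath V x N -> i < N -> j < N -> i != j -> x i != x j.
Proof. by move=> [_ xI _] iN jN; apply: contraNneq => /xI ->. Qed.

Lemma spath_seg V x N i j : npath V x N -> i <= j -> j < N ->
  spath e (seg x i j) (x i) (x j) (j.+1 - i).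
Proof.
move=> px ij; elim: j ij => [|j IH].
  by rewrite leqn0 => /eqP -> _; apply: spath_refl; apply: mem_seg.
rewrite leq_eqVlt => /predU1P[->|]; last rewrite ltnS => ij jN.
  by rewrite subSnn => _; apply: spath_refl; apply: mem_seg; rewrite leqnn.
have [_ xI xe] := px; have p1 := IH ij (ltnW jN).
have p2 := spath_join p1 (spath_edge irr_e (xe j jN)).
apply: spathW (p2 _); last 2 first.
- by lia.
- apply/subsetP => y; rewrite !inE => /andP[/segP[l il ->] /orP[//|/eqP/xI E]].
  by have := E _ _; lia.
apply/subsetP => y; rewrite !inE => /orP[/segP[l il ->]|/orP[]/eqP->];
  apply: mem_seg; lia.
Qed.

Lemma spath_npath V A u v n : A \subset V -> spath e A u v n ->
  exists x N, npath V x N /\ n <= N.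
Proof.
move=> /subsetP AV [s [ps ls us sA sn]]; exists (nth u (u :: s)), (size (u :: s)).
split=> //; split=> [i iN|i j iN jN E|i iN]; first by apply/AV/sA/mem_nth.
  by apply/eqP; rewrite -(nth_uniq u iN jN us) E.
by move/pathP: ps => /(_ u i iN).
Qed.

Definition end_degrees V x N := deg e V (x 0) + deg e V (x N.-1).

Lemma exists_longest V : V != set0 -> exists x N,
  [/\ 0 < N, npath V x N, forall x' N', npath V x' N' -> N' <= N &
      forall x', npath V x' N -> end_degrees V x' N <= end_degrees V x N].
Proof.
case/set0Pn => v vV.
(* Tuples turn the paths with [n] vertices into a finite type, so that both maxima are attained. *)
pose ok n (s : n.-tuple T) := [forall i : 'I_n, (tnth s i \in V) &&
   [forall j : 'I_n, ((tnth s i == tnth s j) ==> (i == j)) &&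
                     ((i.+1 == j) ==> e (tnth s i) (tnth s j))]].
have okP n (s : n.-tuple T) : ok n s -> npath V (nth v s) n.
  move=> /forallP H.
  have tE i (iN : i < n) : nth v s i = tnth s (Ordinal iN) by rewrite (tnth_nth v).
  split=> [i iN|i j iN jN|i iN].
  - by rewrite tE; case/andP: (H (Ordinal iN)).
  - rewrite !tE; case/andP: (H (Ordinal iN)) => _ /forallP/(_ (Ordinal jN))/andP[/implyP I _].
    by move/eqP/I/eqP => [].
  rewrite (tE i (ltnW iN)) (tE _ iN).
  case/andP: (H (Ordinal (ltnW iN))) => _ /forallP/(_ (Ordinal iN))/andP[_ /implyP]; exact.
have Pok n x : npath V x n -> ok n [tuple x i | i < n].
  move=> [xV xI xe]; apply/forallP => i; rewrite tnth_mktuple xV //=.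
  apply/forallP => j; rewrite tnth_mktuple; apply/andP; split; apply/implyP => /eqP.
    by move=> /xI E; apply/eqP/val_inj/E.
  by move=> E; rewrite -E; apply: xe; rewrite E.
have ex1 : exists n, [exists s : n.-tuple T, ok n s].
  exists 1; apply/existsP; exists [tuple (fun=> v) i | i < 1]; apply: Pok.
  by split=> // [[|?]] // [|?].
have bound n : [exists s : n.-tuple T, ok n s] -> n <= #|T|.
  move=> /existsP[s /okP[_ sI _]]; rewrite -(card_ord n).
  apply: (@leq_card _ _ (fun i : 'I_n => nth v s i)) => i j /sI E.
  exact/val_inj/E.
case: (ex_maxnP ex1 bound) => N /existsP[s0 ok0] maxN.
case: (@arg_maxnP _ s0 (ok N) (fun s => end_degrees V (nth v s) N) ok0) => s oks maxs.
exists (nth v s), N; split.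
- by apply: maxN; apply/existsP; exists [tuple (fun=> v) i | i < 1]; apply: Pok; split=> // [[|?]] // [|?].
- exact: okP.
- by move=> x N' px; apply: maxN; apply/existsP; exists [tuple x i | i < N']; exact: Pok.
move=> x px; have := maxs _ (Pok _ _ px); rewrite /end_degrees.
have N0 : 0 < N.
  by apply: maxN; apply/existsP; exists [tuple (fun=> v) i | i < 1]; apply: Pok; split=> // [[|?]] // [|?].
have nE i : i < N -> nth v [tuple x i | i < N] i = x i.
  by move=> iN; rewrite (nth_mktuple _ _ (Ordinal iN)).
by rewrite !nE; lia.
Qed.

Lemma deg_ge2 V v : twoconn e V -> 2 < #|V| -> v \in V -> 1 < deg e V v.
Proof.
move=> tw V3 vV; rewrite ltnNge; apply/negP => d1.
set X := [set y in V | e v y] in d1.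
have [y yV] : exists y, y \in V :\: (v |: X).
  apply/set0Pn; rewrite -card_gt0 cardsD.
  have := subset_leq_card (subsetIr V (v |: X)).
  have := leq_of_leqif (leq_card_setU [set v] X); rewrite cards1; move: d1; rewrite /deg -/X; lia.
move: yV; rewrite in_setD in_setU1 negb_or => /andP[/andP[yv nyX] yV].
have cV := tw X d1.
have [|||a [b [/set1P -> bV _ evb]]] := conn_exit cV (A := [set v]).
- by rewrite sub1set !inE irr_e andbF vV.
- by apply/set0Pn; exists v; rewrite inE.
- apply: contraNneq yv => E; suff : y \in [set v] by rewrite inE.
  by rewrite E in_setD nyX.
by move: bV; rewrite !inE evb; case: (b \in V).
Qed.

Section Ends.
Variables (V : {set T}) (k : nat).
Hypotheses (nlc : no_long_cycle e k V) (tw : twoconn e V) (kV : k <= #|V|) (k3 : 3 < k).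

Section Path.
Variables (x : nat -> T) (N : nat).
Hypotheses (N0 : 0 < N) (px : npath V x N) (mx : forall x' N', npath V x' N' -> N' <= N).

Let seg_sub i j : j < N -> seg x i j \subset V.
Proof. by move=> jN; apply/subsetP => y /segP[l lj ->]; case: px => xV _ _; apply: xV; lia. Qed.

Lemma longest_spath A u v n : A \subset V -> spath e A u v n -> n <= N.
Proof. by move=> AV /(spath_npath AV)[x' [N' [/mx xN' nN']]]; apply: leq_trans xN'. Qed.

(** A neighbour of the start off the path would extend the path. *)
Lemma longest_nbr y : y \in V -> e (x 0) y -> exists2 i, i < N & y = x i.
Proof.
move=> yV exy; have [/segP[l lN ->]|yA] := boolP (y \in seg x 0 N.-1).
  by exists l => //; lia.
have NN : N.-1 < N by lia.
have p1 := spath_seg px (leq0n N.-1) NN.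
have p2 := spath_join (spath_sym sym_e (spath_edge irr_e exy)) p1.
suff : 2 + (N.-1.+1 - 0) <= N.+1 by lia.
rewrite -[X in X <= _]prednK //; apply: (@longest_spath _ y (x N.-1) _ _ (p2 _)).
  by rewrite !subUset !sub1set yV seg_sub //; case: px => xV _ _; rewrite xV.
by apply/subsetP => w; rewrite !inE => /andP[/orP[//|/eqP ->]]; rewrite (negPf yA).
Qed.

Definition start_nbrs : {set 'I_N} := [set i : 'I_N | e (x 0) (x i)].

Lemma card_start_nbrs : #|start_nbrs| = deg e V (x 0).
Proof.
have [xV xI _] := px; rewrite -(card_in_imset (f := fun i : 'I_N => x i)); last first.
  by move=> i j _ _ /xI E; apply/val_inj/E.
congr #|pred_of_set _|; apply/setP => y; apply/imsetP/idP.
  by case=> i; rewrite !inE => ei ->; rewrite xV.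
rewrite inE => /andP[yV ey]; have [i iN yE] := longest_nbr yV ey.
by exists (Ordinal iN); rewrite ?inE /= -?yE.
Qed.

Lemma start_nbrs_gt0 (i : 'I_N) : i \in start_nbrs -> 0 < i.
Proof. by rewrite inE lt0n; apply: contraTneq => ->; rewrite irr_e. Qed.

Lemma good_start (a : nat) : a < N -> e (x 0) (x a) ->
  (forall i, i < N -> e (x 0) (x i) -> i <= a) ->
  good e (seg x 0 a) (x a) (deg e V (x 0)).+1.
Proof.
move=> aN ea maxa; split; first by apply: mem_seg; rewrite leqnn.
move=> _ /segP[i ia ->] ia'; have {}ia : i < a.
  by rewrite ltn_neqAle; case/andP: ia => _ ->; rewrite andbT; apply: contraNneq ia' => ->.
have [l /andP[il el] minl] : exists2 l, (i < l) && e (x 0) (x l) &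
    forall m, (i < m) && e (x 0) (x m) -> l <= m.
  have ex : exists l, (i < l) && e (x 0) (x l) by exists a; rewrite ia.
  by case: (ex_minnP ex) => l ? ?; exists l.
have la : l <= a by apply: minl; rewrite ia.
have p1 := spath_sym sym_e (spath_seg px (leq0n i) (ltn_trans ia aN)).
have p2 := spath_seg px la aN.
have [xV xI xe] := px.
have p12 := spath_join p1 (spath_edge irr_e el).
have sub1 : seg x 0 i :&: [set x 0; x l] \subset [set x 0].
  apply/subsetP => y; rewrite !inE => /andP[/segP[m mi ->] /orP[//|/eqP/xI E]].
  by have := E _ _; lia.
have p3 := spath_join (p12 sub1) p2.
apply: spathW (p3 _).
- apply/subsetP => y; rewrite !inE => /orP[/orP[/segP[m mi ->]|/orP[]/eqP->]|/segP[m ml ->]];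
    apply: mem_seg; lia.
- rewrite -card_start_nbrs.
  have -> : start_nbrs = [set j in start_nbrs | j <= i] :|: [set j in start_nbrs | l <= j].
    apply/setP => j; rewrite !inE; case ej: (e _ _) => //=.
    case: leqP => //= ij; apply/esym/minl; by rewrite ij.
  apply: leq_trans (_ : ((i.+1 - 1) + (a.+1 - l)).+1 <= _); last lia.
  rewrite ltnS; apply: leq_trans (leq_card_setU _ _) (leq_add _ _); apply: card_ord_itv => j.
    by rewrite inE => /andP[/start_nbrs_gt0]; lia.
  by rewrite !inE => /andP[ej]; have := maxa j (ltn_ord j) ej; lia.
apply/subsetP => y; rewrite !inE => /andP[/orP[/segP[m mi ->]|/orP[]/eqP->] /segP[m' ml /xI E]] //.
  by have := E _ _; lia.
by have := E _ _; lia.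
Qed.

End Path.

(** If some neighbour of the last vertex precedes a neighbour of the first one, the two chords close
    a cycle with at least as many vertices as the degree sum. If not, the two ends span pieces to
    which [good_link] applies. *)
Lemma longest_ends x N : 0 < N -> npath V x N -> (forall x' N', npath V x' N' -> N' <= N) ->
  end_degrees V x N < k.
Proof.
move=> N0 px mx; have NN : N.-1 < N by lia.
have [xV xI xe] := px.
have V2 : 2 < #|V| by lia.
have xI' i j : i < N -> j < N -> x i = x j -> i = j by exact: xI.
pose x' i := x (N.-1 - i); have px' : npath V x' N := npath_rev px.
have x'0 : x' 0 = x N.-1 by rewrite /x' subn0.
have nbr_last y : y \in V -> e (x N.-1) y -> exists2 i, i < N.-1 & y = x i.
  move=> yV; rewrite -x'0 => ey; have [i iN yE] := longest_nbr N0 px' mx yV ey.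
  exists (N.-1 - i) => //; have : i != 0; last lia.
  by apply: contraTneq ey => i0; rewrite yE i0 irr_e.
have sS i j : j < N -> seg x i j \subset V.
  by move=> jN; apply/subsetP => y /segP[l lj ->]; apply: xV; lia.
have [/existsP[[i0 j0] cross0]|nocross] := boolP
    [exists q : 'I_N * 'I_N, [&& q.1 < q.2, e (x 0) (x q.2) & e (x N.-1) (x q.1)]].
  case: (@arg_minnP _ (i0, j0) (fun q : 'I_N * 'I_N =>
     [&& q.1 < q.2, e (x 0) (x q.2) & e (x N.-1) (x q.1)]) (fun q => q.2 - q.1) cross0).
  (* The crossing pair has minimal gap [j - i]. Its cycle is [x 0], ..., [x i], [x N.-1], ...,
     [x j], with [i + 1 + (N - j)] vertices. *)
  move=> [i j] /= /and3P[ij ej ei] minij {i0 j0 cross0}.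
  have iN := ltn_ord i; have jN := ltn_ord j.
  have gap l m : l < m -> m < N -> e (x 0) (x m) -> e (x N.-1) (x l) -> j - i <= m - l.
    move=> lm mN em el; have lN : l < N by lia.
    by apply: (minij (Ordinal lN, Ordinal mN)); rewrite /= lm em.
  have p1 := spath_seg px (leq0n i) iN.
  have p2 := spath_sym sym_e (spath_seg px (_ : j <= N.-1) NN).
  have jN1 : j <= N.-1 by lia.
  have iN1 : i < N.-1.
    by rewrite ltn_neqAle -ltnS prednK // iN andbT; apply: contraTneq ei => ->; rewrite irr_e.
  have p12 := spath_join p1 (spath_edge irr_e (_ : e (x i) (x N.-1))).
  have eiN : e (x i) (x N.-1) by rewrite sym_e.
  have sub1 : seg x 0 i :&: [set x i; x N.-1] \subset [set x i].
    apply/subsetP => y; rewrite !inE => /andP[/segP[m mi ->] /orP[//|/eqP/xI' E]].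
    by have := E _ _; lia.
  have sub2 : (seg x 0 i :|: [set x i; x N.-1]) :&: seg x j N.-1 \subset [set x N.-1].
    apply/subsetP => y; rewrite !inE => /andP[/orP[/segP[m mi ->]|/orP[]/eqP->] /segP[m' ml /xI' E]] //;
    by have := E _ _; lia.
  have := spath_join (p12 eiN sub1) (p2 jN1) sub2.
  set A := _ :|: _; set L := _.-1 => pA.
  have AV : A \subset V by rewrite !subUset !sub1set !sS ?xV.
  have LE : L = i.+1 + (N - j) by rewrite /L; lia.
  have ej' : e (x j) (x 0) by rewrite sym_e.
  (* With gap 1 the cycle covers the whole path: either it is Hamiltonian in [V] and too long, or
     opening it next to an outside vertex yields a longer path. *)
  have [ji|ji] := eqVneq (j : nat) i.+1.
    have LN : L = N by rewrite LE; lia.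
    have AE : #|A| <= N.
      have -> : A = seg x 0 N.-1; last by apply: leq_trans (card_seg _ _ _) _; lia.
      apply/setP => y; apply/idP/segP.
        rewrite !inE => /orP[/orP[/segP[m mi ->]|/orP[]/eqP->]|/segP[m mi ->]];
          by [exists m => //; lia | exists (i : nat) => //; lia | exists N.-1 => //; lia].
      move=> [m mN ->]; rewrite !inE; have [le|lt] := leqP m i.
        by rewrite mem_seg.
      by rewrite [X in _ || X]mem_seg ?orbT //; lia.
    have [AVe|AV'] := eqVneq A V.
      have NV : k <= N by apply: leq_trans kV _; rewrite -AVe.
      have := spath_cycle nlc AV pA ej'; lia.
    have c0 : conn e V.
      by have := tw (X := set0); rewrite cards0 setD0; apply.
    have [|||u [y [uA yV yA uy]]] := conn_exit c0 (A := A) => //.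
      by apply/set0Pn; exists (x 0); rewrite !inE mem_seg.
    have [|w pw] := spath_rot pA _ ej' uA; first by rewrite LN.
    have eyu : e y u by rewrite sym_e.
    have := spath_join (spath_edge irr_e eyu) pw.
    have -> : [set y; u] :&: A \subset [set u].
      by apply/subsetP => z /setIP[/set2P[->|->] zA]; [rewrite zA in yA | rewrite set11].
    have yAV : [set y; u] :|: A \subset V.
      rewrite subUset AV andbT; apply/subsetP => z /set2P[->//|->].
      exact: (subsetP AV).
    by move=> /(_ isT)/(longest_spath mx yAV); rewrite LN add2n /= ltnn.
  have dL : end_degrees V x N <= L.
    (* Neighbours of the last vertex are shifted to their successors. By minimality of the gap, this
       set and [start_nbrs] are disjoint and avoid the indices strictly between [i + 1] and [j],
       which leaves as many places as the cycle has vertices. *)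
    pose I1 := [set l : 'I_N | (0 < l) && e (x N.-1) (x l.-1)].
    have d1 : deg e V (x N.-1) <= #|I1|.
      apply: leq_trans (leq_imset_card (fun l : 'I_N => x l.-1) I1).
      apply/subset_leq_card/subsetP => y; rewrite inE => /andP[yV ey].
      have [l lN yE] := nbr_last y yV ey; have lN' : l.+1 < N by lia.
      by apply/imsetP; exists (Ordinal lN'); rewrite ?inE /= -?yE.
    rewrite /end_degrees -(card_start_nbrs N0 px mx).
    apply: leq_trans (leq_add (leqnn _) d1) _.
    have I01 : start_nbrs x N :&: I1 = set0.
      apply/setP => l; rewrite !inE; apply/negP => /and3P[e0 l0 e1].
      by have := @gap l.-1 l _ _ e0 e1; have := ltn_ord l; lia.
    rewrite -cardsUI I01 cards0 addn0.
    have splitU (U : {set 'I_N}) : (forall l, l \in U -> ~~ (i.+1 < l < j)) ->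
        U = [set l in U | l <= i.+1] :|: [set l in U | j <= l].
      move=> H; apply/setP => l; rewrite !inE -andb_orr.
      by case lU: (l \in U) => //=; have := H l lU; rewrite negb_and -!leqNgt => ->.
    rewrite (splitU (_ :|: _)) => [|l]; last first.
      rewrite !inE => el; apply/negP => /andP[il lj]; case/orP: el => [el|/andP[l0 el]].
        by have := @gap i l _ _ el ei; lia.
      by have := @gap l.-1 j _ _ ej el; lia.
    apply: leq_trans (leq_card_setU _ _) _; rewrite LE.
    apply: leq_add.
      rewrite -[i.+1]/(i.+2 - 1); apply: card_ord_itv => l.
      rewrite inE => /andP[/setUP[/(start_nbrs_gt0)|]]; first by lia.
      by rewrite inE => /andP[]; lia.
    by apply: card_ord_itv => l; rewrite inE => /andP[_]; have := ltn_ord l; lia.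
  apply: (leq_ltn_trans dL); apply: (spath_cycle nlc AV pA ej').
  have := deg_ge2 tw V2 (xV _ N0); have := deg_ge2 tw V2 (xV _ NN).
  by move: dL; rewrite /end_degrees; lia.
have [i0 i0I] : exists i, i \in start_nbrs x N.
  by apply/set0Pn; rewrite -card_gt0 (card_start_nbrs N0 px mx) ltnW // deg_ge2 ?xV.
have [j0 j0I] : exists i, i \in start_nbrs x' N.
  apply/set0Pn; rewrite -card_gt0 (card_start_nbrs N0 px' mx) ltnW // deg_ge2 //.
  by rewrite x'0 xV.
case: (@arg_maxnP _ i0 (fun i => i \in start_nbrs x N) val i0I) => a aI maxa.
case: (@arg_maxnP _ j0 (fun i => i \in start_nbrs x' N) val j0I) => b' bI maxb.
have aN := ltn_ord a; have bN := ltn_ord b'.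
move: (aI) (bI); rewrite !inE => ea eb.
have gA := good_start N0 px mx aN ea (fun i iN ei => maxa (Ordinal iN) (etrans (in_set _ _) ei)).
have gB := good_start N0 px' mx bN eb (fun i iN ei => maxb (Ordinal iN) (etrans (in_set _ _) ei)).
have a0 : 0 < a := start_nbrs_gt0 aI.
have b0 : 0 < b' := start_nbrs_gt0 bI.
pose b := N.-1 - b'; have xb : x' b' = x b by [].
have ab : a <= b.
  rewrite leqNgt; apply: contraNN nocross => ba.
  have bN' : b < N by rewrite /b; lia.
  by apply/existsP; exists (Ordinal bN', a); rewrite /= ba ea -xb -x'0 eb.
rewrite /end_degrees -x'0.
(* No crossing: the last neighbour [x a] of the start comes no later than the first neighbour [x b]
   of the end. The stretch from [x a] to [x b], trivial if [a = b], links the two good pieces. *)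
suff : (deg e V (x 0)).+1 + (deg e V (x' 0)).+1 <= k by lia.
rewrite xb in gB.
pose P := [seq x i | i <- iota a.+1 (b - a)].
have memP y : y \in P -> exists2 l, a < l <= b & y = x l.
  by move=> /mapP[l]; rewrite mem_iota => lab ->; exists l => //; lia.
have Pe n c : c + n < N -> path e (x c) [seq x i | i <- iota c.+1 n] /\
    last (x c) [seq x i | i <- iota c.+1 n] = x (c + n).
  elim: n c => [|n IH] c cN /=; first by rewrite addn0.
  have [] := IH c.+1; first by lia.
  by rewrite xe ?addnS //; lia.
have bN1 : b < N by rewrite /b; lia.
have [] := Pe (b - a) a; first by lia.
rewrite -/P subnKC // => pP lP.
have d0 := deg_ge2 tw V2 (xV 0 N0); have dN := deg_ge2 tw V2 (xV N.-1 NN).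
apply: (good_link sym_e irr_e nlc tw _ _ _ gB (b' := x' 0) _ _ _ gA (P := P) (u := x 0)) => //.
- exact: ltnW.
- by rewrite x'0 ltnW.
- by apply/subsetP => y /segP[l lb ->]; case: px' => x'V _ _; apply: x'V; lia.
- exact: mem_seg.
- by rewrite -xb; apply: (npath_neq px') => //; rewrite neq_ltn b0.
- exact: sS.
- exact: mem_seg.
- by apply: (npath_neq px) => //; rewrite neq_ltn a0.
- rewrite -[_ :: _]/[seq x i | i <- iota a (b - a).+1] map_inj_in_uniq ?iota_uniq //.
  by move=> l m; rewrite !mem_iota => la ma /xI; apply; lia.
- by move=> y /memP[l lb ->]; apply: xV; lia.
- move=> y /memP[l lb ->]; apply/negP => /segP[m ma /xI E].
  by have := E _ _; lia.
move=> y /segP[l lb ->] H; have : exists2 m, m <= b & x' l = x m.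
  by case/orP: H => [/segP[m ma ->]|/memP[m ma ->]]; exists m => //; lia.
move=> [m mb /xI E]; rewrite /x'; congr (x _).
by have := E _ _; rewrite /b in mb *; lia.
Qed.

(** [S] consists of the predecessors on the path of the neighbours of the end of smaller degree.
    Each of them is the end of a rotated path of the same length with the same other end, so
    maximality of the degree sum bounds its degree. *)
Lemma posa_vertices : exists S : {set T},
  [/\ S \subset V, 1 < #|S|, #|S|.*2 < k & {in S, forall z, deg e V z <= #|S|}].
Proof.
have V0 : V != set0 by rewrite -card_gt0; lia.
have [x [N [N0 px mx md]]] := exists_longest V0.
wlog le : x px md / deg e V (x 0) <= deg e V (x N.-1).
  move=> H; case: (leqP (deg e V (x 0)) (deg e V (x N.-1))) => [|/ltnW lt]; first exact: H.
  have swap x1 : end_degrees V (fun i => x1 (N.-1 - i)) N = end_degrees V x1 N.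
    by rewrite /end_degrees subn0 subnn addnC.
  apply: (H _ (npath_rev px)); rewrite ?subn0 ?subnn //.
  by move=> x1 px1; rewrite swap; apply: md.
have [xV xI xe] := px.
have dk := longest_ends N0 px mx.
pose S := [set x i.-1 | i : 'I_N in start_nbrs x N].
have SE : #|S| = deg e V (x 0).
  rewrite -(card_start_nbrs N0 px mx); apply: card_in_imset => i j iI jI /xI E.
  have := start_nbrs_gt0 iI; have := start_nbrs_gt0 jI.
  have iN := ltn_ord i; have jN := ltn_ord j; move=> j0 i0.
  by apply/val_inj; have := E _ _; rewrite /=; lia.
exists S; rewrite SE; split.
- by apply/subsetP => _ /imsetP[i _ ->]; apply: xV; have := ltn_ord i; lia.
- by apply: deg_ge2; rewrite ?xV //; lia.
- by move: dk; rewrite /end_degrees; lia.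
move=> _ /imsetP[i iI ->]; have i0 := start_nbrs_gt0 iI; have iN := ltn_ord i.
move: iI; rewrite inE => ei.
(* The rotation: the first [i] vertices are reversed, and the edge from [x 0] to [x i] joins them to
   the rest. *)
pose y l := if l < i then x (i.-1 - l) else x l.
have py : npath V y N.
  split=> [l lN|l m lN mN|l lN]; rewrite /y.
  - by case: ifP => _; apply: xV; lia.
  - by case: ltnP => li; case: ltnP => mi /xI E; have := E _ _; lia.
  case: ltnP => li; case: ltnP => li'; try lia.
  + have := xe (i.-1 - l.+1); rewrite sym_e.
    by rewrite (_ : (i.-1 - l.+1).+1 = i.-1 - l); [apply|]; lia.
  + have -> : i.-1 - l = 0 by lia.
    by have -> : l.+1 = i by lia.
  exact: xe.
have := md y py; rewrite /end_degrees /y i0 subn0 ltnNge.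
have -> : i <= N.-1 by lia.
by rewrite leq_add2r.
Qed.

End Ends.
End LongestPaths.

(** * Contraction and clique counts *)

Section CliqueCounts.
Variable T : finType.
Implicit Types (e : rel T) (V A B S : {set T}) (u v w x y z : T).

Lemma cliques_rel e e' t V : subrel e e' -> #|cliques e t V| <= #|cliques e' t V|.
Proof.
move=> ee'; apply/subset_leq_card/subsetP => A; rewrite !inE => /and3P[-> ->] /cliqueP cA.
by apply/cliqueP => x y xA yA xy; apply/ee'/cA.
Qed.

Lemma cliques_bin e t V : #|cliques e t V| <= 'C(#|V|, t).
Proof.
rewrite -cards_draws; apply/subset_leq_card/subsetP => A.
by rewrite !inE => /and3P[-> ->].
Qed.

(** Removing [v] maps the [t]-cliques through [v] injectively to [(t - 1)]-sets of neighbours. *)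
Lemma cliques_del e t V v : 0 < t ->
  #|cliques e t V| <= #|cliques e t (V :\ v)| + 'C(deg e V v, t.-1).
Proof.
move=> t0; rewrite -(cardsID [set A : {set T} | v \notin A]) leq_add //.
  apply/subset_leq_card/subsetP => A; rewrite !inE => /andP[/and3P[AV -> ->]] vA.
  by rewrite !andbT subsetD1 AV.
rewrite -cards_draws -(card_in_imset (f := fun A : {set T} => A :\ v)); last first.
  move=> A B; rewrite !inE !negbK => /andP[vA _] /andP[vB _] E.
  by rewrite -(setD1K vA) E setD1K.
apply/subset_leq_card/subsetP => _ /imsetP[A Acl ->]; move: Acl.
rewrite !inE negbK => /andP[vA /and3P[AV /eqP tA /cliqueP cA]].
apply/andP; split; last by have := cardsD1 v A; rewrite vA tA => ->.
apply/subsetP => y; rewrite !inE => /andP[yv yA].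
by rewrite (subsetP AV) ?cA // eq_sym.
Qed.

Lemma deg_sub e V A u : A \subset V -> deg e A u <= deg e V u.
Proof.
move=> /subsetP AV; apply/subset_leq_card/subsetP => y.
by rewrite !inE => /andP[/AV -> ->].
Qed.

Lemma cliques_delset e t V S d : 0 < t -> {in S, forall z, deg e V z <= d} ->
  #|cliques e t V| <= #|cliques e t (V :\: S)| + #|S| * 'C(d, t.-1).
Proof.
move=> t0; have [n] := ubnP #|S|; elim: n S V => [//|n IH] S V; rewrite ltnS => Sn dS.
have [->|[z zS]] := set_0Vmem S; first by rewrite setD0 cards0 addn0.
have Sz := cardsD1 z S; rewrite zS add1n in Sz.
have Sn' : #|S :\ z| < n by rewrite -Sz.
have := IH (S :\ z) (V :\ z) Sn'.
have -> : (V :\ z) :\: (S :\ z) = V :\: S.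
  by apply/setP => y; rewrite !inE; case: eqVneq => [->|]; rewrite ?zS ?andbF.
move=> H; have {}H := H _; apply: leq_trans (cliques_del e V z t0) _.
have Hd : 'C(deg e V z, t.-1) <= 'C(d, t.-1) by apply/leq_bin2l/dS.
rewrite Sz mulSn addnCA addnC; apply: leq_add => //; apply: H => y.
rewrite !inE => /andP[_ yS]; apply: leq_trans (dS y yS).
by apply: deg_sub; apply: subsetDl.
Qed.

End CliqueCounts.

Section Contraction.
Variables (T : finType) (e : rel T).
Hypotheses (sym_e : symmetric e) (irr_e : irreflexive e).
Implicit Types (V A X : {set T}) (u v w x y z : T).

(* The edge [v w] is contracted onto [w]: the vertex [v] is to be dropped. *)
Definition contract v w : rel T := fun x y =>
  (x != y) && [|| e x y, (x == w) && e v y | (y == w) && e x v].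

Lemma contract_sym v w : symmetric (contract v w).
Proof.
move=> x y; rewrite /contract eq_sym (sym_e x y) (sym_e x v) (sym_e v y).
by congr (_ && (_ || _)); rewrite orbC.
Qed.

Lemma contract_irr v w : irreflexive (contract v w).
Proof. by move=> x; rewrite /contract eqxx. Qed.

Lemma sub_contract v w : subrel e (contract v w).
Proof.
by move=> x y exy; rewrite /contract exy andbT; apply: contraTneq exy => ->; rewrite irr_e.
Qed.

Lemma contract_neq v w x y : x != w -> y != w -> contract v w x y = e x y.
Proof.
move=> /negPf xw /negPf yw; rewrite /contract xw yw /= orbF andb_idl //.
by apply: contraTneq => ->; rewrite irr_e.
Qed.

Lemma deg_contract V v w u : deg e V u <= (deg (contract v w) (V :\ v) u).+1.
Proof.
rewrite -add1n -[X in _ <= X + _](cards1 v); apply: leq_trans (leq_card_setU _ _).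
apply/subset_leq_card/subsetP => y; rewrite !inE => /andP[yV euy].
by rewrite yV andbT; case: eqVneq => //= _; exact: sub_contract.
Qed.

(* Choose [w] so that the component of a fixed neighbor of [v] in [V - v - w]
   is as large as possible. *)
Lemma exists_contractible V v : twoconn e V -> 2 < #|V| -> v \in V ->
  exists w, [/\ w \in V, e v w & conn e (V :\ v :\ w)].
Proof.
move=> tw V3 vV; have := deg_ge2 irr_e tw V3 vV.
move=> /card_gt1P[r [w0 []]]; rewrite !inE => /andP[rV evr] /andP[wV0 evw0] rw0.
have nv u : e v u -> u != v by apply: contraTneq => ->; rewrite irr_e.
pose C w := [set u | connect (res e (V :\ v :\ w)) r u].
pose P w := [&& w \in V, e v w & w != r].
have P0 : P w0 by rewrite /P wV0 evw0 eq_sym.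
case: (@arg_maxnP _ w0 P (fun w => #|C w|) P0) => w /and3P[wV evw wr] maxw.
have CV u : u \in C w -> u \in V :\ v :\ w.
  rewrite inE; apply: (connect_closed (A := V :\ v :\ w)) => [a _ b /and3P[]//|].
  by rewrite !inE eq_sym wr nv.
exists w; split=> //.
have symr : connect_sym (res e (V :\ v :\ w)) by apply/sym_connect_sym/res_sym.
have [allC|] := boolP (V :\ v :\ w \subset C w).
  move=> a b /(subsetP allC); rewrite inE symr => ra /(subsetP allC).
  by rewrite inE; apply: connect_trans.
case/subsetPn => y yV yC.
pose D := [set u | connect (res e (V :\ v :\ w)) y u].
have DV u : u \in D -> u \in V :\ v :\ w.
  by rewrite inE; apply: (connect_closed (A := V :\ v :\ w)) => // a _ b /and3P[].
have rD : r \notin D by rewrite inE symr; move: yC; rewrite inE.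
have cw : conn e (V :\ w) by apply: tw; rewrite cards1.
have cv : conn e (V :\ v) by apply: tw; rewrite cards1.
have vw : v != w by rewrite eq_sym nv.
(* Assume a second component [D]. As [V - w] is connected, [D] has an edge to [v], and its end [a]
   in [D] competes with [w]. *)
have [|||a [b [aD bV bD eab]]] := conn_exit cw (A := D).
- by apply/subsetP => u /DV; rewrite !inE => /and3P[-> _ ->].
- by apply/set0Pn; exists y; rewrite inE connect0.
- by apply: contraTneq (vV) => DE; have := DV v; rewrite DE !inE eqxx vw andbF /= => /implyP; case: (v \in V).
have aV := DV a aD.
have bv : b = v.
  apply/eqP; apply: contraNT bD => bv; rewrite inE in aD; rewrite inE.
  apply: connect_trans aD (connect1 _); rewrite /res aV eab andbT !inE bv.
  by move: bV; rewrite !inE.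
move: aV eab; rewrite bv !inE sym_e => /and3P[aw av aV] eva.
have ar : a != r by apply: contraNneq rD => <-.
have Pa : P a by rewrite /P aV eva ar.
have aC : a \notin C w.
  apply: contra yC; rewrite inE => ra; rewrite inE; apply: connect_trans ra _.
  by rewrite symr; rewrite inE in aD.
(* Deleting [a] instead of [w] leaves [C w] intact, since [a] lies in another component; it also
   adds [w], to which [C w] is joined because [V - v] is connected. This contradicts the choice of
   [w]. *)
have subC : C w \subset C a.
  apply/subsetP => u uC; suff : u \in C w :&: C a by rewrite inE => /andP[].
  move: (uC); rewrite inE; apply: (connect_closed (A := C w :&: C a)); last first.
    by rewrite !inE !connect0.
  move=> p /setIP[pC pCa] q pq.
  have qC : q \in C w by move: pC; rewrite !inE => /connect_trans; apply; exact: connect1.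
  rewrite inE qC inE; move: pCa; rewrite inE => /connect_trans; apply; apply: connect1.
  have := CV _ pC; have := CV _ qC; case/and3P: pq => _ _ epq.
  rewrite !inE /res !inE epq => /and3P[_ -> ->] /and3P[_ -> ->].
  by rewrite !andbT; apply/andP; split; apply: contraNneq aC => <-.
have wCw : w \notin C w by apply/negP => /CV; rewrite !inE eqxx.
have wCa : w \in C a.
  have [|||p [q [pC qV qC epq]]] := conn_exit cv (A := C w).
  - by apply/subsetP => u /CV; rewrite !inE => /and3P[_ -> ->].
  - by apply/set0Pn; exists r; rewrite inE connect0.
  - by apply: contraNneq aC => ->; rewrite !inE av.
  have qw : q = w.
    apply/eqP; apply: contraNT qC => qw; have := CV p pC => pV.
    rewrite inE in pC; rewrite inE; apply: connect_trans pC (connect1 _).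
    by rewrite /res pV epq andbT in_setD1 qw qV.
  rewrite qw in epq; have := subsetP subC _ pC; rewrite !inE => /connect_trans; apply.
  apply: connect1; have := CV _ pC; rewrite /res !inE epq => /and3P[_ -> ->].
  by rewrite wV (eq_sym w v) vw (eq_sym w a) aw !andbT; apply: contraNneq aC => <-.
suff : #|C w| < #|C a| by move=> lt; have := leq_trans lt (maxw a Pa); rewrite ltnn.
apply: proper_card.
by rewrite properE subC; apply/subsetPn; exists w.
Qed.

Lemma connect_hom (S : finType) (r : rel T) (r' : rel S) (f : T -> S) :
  (forall x y, r x y -> connect r' (f x) (f y)) ->
  forall x y, connect r x y -> connect r' (f x) (f y).
Proof.
move=> rr' x y /connectP[p + ->] {y}; elim: p x => [|y p IH] x /=; first by rewrite connect0.
by move=> /andP[/rr' xy /IH]; exact: connect_trans.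
Qed.

(** If [X] removes [w], what is left is [V - v - w], connected by hypothesis. Otherwise sending [v]
    to [w] carries walks in [V] to walks in the contraction; [v] is dropped from [X] because its
    image has to stay. *)
Lemma twoconn_contract V v w : twoconn e V -> w \in V -> e v w ->
  conn e (V :\ v :\ w) -> twoconn (contract v w) (V :\ v).
Proof.
move=> tw wV evw cvw X X1.
have wv : w != v by apply: contraTneq evw => ->; rewrite irr_e.
have [wX|wX] := boolP (w \in X).
  have -> : X = [set w].
    by apply/eqP; rewrite eq_sym eqEcard sub1set wX cards1.
  move=> x y xV yV; have := cvw x y xV yV; apply: connect_mono => a b.
  by rewrite /res => /and3P[-> -> /= /sub_contract].
move=> y z yV zV; pose f u := if u == v then w else u.
have X'1 : #|X :\ v| <= 1 by apply: leq_trans X1; apply/subset_leq_card/subsetDl.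
have fE u : u \in V :\ v :\: X -> f u = u /\ u \in V :\: (X :\ v).
  by rewrite /f !inE => /and3P[/negPf -> /negPf -> ->]; rewrite andbF.
have [fy yV'] := fE y yV; have [fz zV'] := fE z zV.
rewrite -fy -fz; apply: connect_hom (tw _ X'1 y z yV' zV') => {y z yV zV fy fz yV' zV'}.
move=> a b; rewrite /res !inE !negb_and !negbK => /and3P[/andP[aX aV] /andP[bX bV] eab].
rewrite /f; case: (eqVneq a v) (eqVneq b v) => [av|av] [bv|bv].
- by rewrite connect0.
- have [<-|wb] := eqVneq w b; first by rewrite connect0.
  apply: connect1; rewrite /contract !inE wX wV wv bV bv wb eqxx -av eab !orbT !andbT.
  by move: bX; rewrite (negPf bv).
- have [<-|aw] := eqVneq a w; first by rewrite connect0.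
  apply: connect1; rewrite /contract !inE wX wV wv aV av aw eqxx -bv eab !orbT !andbT.
  by move: aX; rewrite (negPf av).
apply: connect1; rewrite !inE (sub_contract _ _ eab) av bv aV bV !andbT.
by move: aX bX; rewrite (negPf av) (negPf bv) /= => -> ->.
Qed.

(** Each of the two cycle edges at [w] comes from an edge at [w] or at [v]. If both come from the
    same vertex, that vertex is put in place of [w]; if they differ, the edge [v w] is inserted and
    the cycle only gets longer. *)
Lemma no_long_contract k V v w : v \in V -> w \in V -> e v w ->
  no_long_cycle e k V -> no_long_cycle (contract v w) k (V :\ v).
Proof.
move=> vV wV evw nlc c cV c2 cc uc.
have cV' : {subset c <= V} by move=> x /cV; rewrite inE => /andP[].
have vc : v \notin c by apply/negP => /cV; rewrite !inE eqxx.
have [wc|wc] := boolP (w \in c); last first.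
  apply: nlc => //; apply: (sub_in_cycle (P := predC1 w)) cc => [x y xw yw|].
    by rewrite contract_neq.
  by apply/allP => x xc; apply: contraNneq wc => <-.
have [i p rE] := rot_to wc.
have [up cp] : uniq (w :: p) /\ cycle (contract v w) (w :: p).
  by rewrite -rE rot_uniq rot_cycle.
have sp : size c = (size p).+1 by rewrite -(size_rot i) rE.
have pc x : x \in w :: p -> x \in c by rewrite -rE mem_rot.
rewrite sp in c2 *.
case: p => [|y q] in rE up cp sp pc c2 *; first by [].
have nw x : x \in y :: q -> x != w.
  by move=> xq; case/andP: up => wyq _; apply: contraNneq wyq => <-.
have nv x : x \in w :: y :: q -> x != v.
  by move=> /pc xc; apply: contraNneq vc => <-.
have wyV x : x \in w :: y :: q -> x \in V by move=> /pc/cV'.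
move: cp; rewrite /cycle rcons_path /= => /andP[/andP[ewy pyq] elw].
have {}pyq : path e y q.
  have nwq : all (predC1 w) (y :: q) by apply/allP => x /nw.
  apply: sub_in_path nwq pyq => a b aw bw; by rewrite contract_neq.
have lq : last y q \in y :: q := mem_last y q.
have wyw : w \notin y :: q by case/andP: up.
have vyq : v \notin w :: y :: q by apply/negP => /nv; rewrite eqxx.
have uyq : uniq (y :: q) by case/andP: up.
have {}ewy : e w y || e v y.
  by move: ewy; rewrite /contract eqxx (negPf (nw y _)) ?mem_head //= orbF => /andP[].
have {}elw : e (last y q) w || e (last y q) v.
  by move: elw; rewrite /contract eqxx (negPf (nw _ lq)) //= => /andP[].
have [ey|evy] := orP ewy; have [el|elv] := orP elw.
- apply: (nlc (w :: y :: q)) => //; last by rewrite /cycle rcons_path /= ey pyq.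
- apply: ltn_trans (ltnSn _) _.
  apply: leq_trans (nlc (w :: rcons (y :: q) v) _ _ _ _).
  + by rewrite /= size_rcons.
  + by move=> x; rewrite inE mem_rcons inE -orbCA => /predU1P[-> //|/wyV].
  + by rewrite /= size_rcons.
  + by rewrite /cycle rcons_path /= rcons_path last_rcons ey pyq elv evw.
  rewrite cons_uniq rcons_uniq uyq mem_rcons inE negb_or wyw (nv w) ?mem_head //= andbT.
  by move: vyq; rewrite inE negb_or => /andP[].
- apply: ltn_trans (ltnSn _) _.
  apply: leq_trans (nlc (v :: rcons (y :: q) w) _ _ _ _).
  + by rewrite /= size_rcons.
  + by move=> x; rewrite inE mem_rcons -in_cons => /predU1P[-> //|/wyV].
  + by rewrite /= size_rcons.
  + by rewrite /cycle rcons_path /= rcons_path last_rcons evy pyq el sym_e evw.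
  by rewrite cons_uniq rcons_uniq uyq mem_rcons vyq wyw.
apply: (nlc (v :: y :: q)) => //; first last.
- by move: vyq; rewrite inE negb_or cons_uniq uyq andbT => /andP[].
- by rewrite /cycle rcons_path /= evy pyq.
by move=> x; rewrite inE => /predU1P[-> //|xq]; apply: wyV; rewrite inE xq orbT.
Qed.

End Contraction.

(* Contract repeatedly a vertex of minimum degree down to [k] vertices, where
   Posa's condition applies; a contraction decreases degrees by at most one, so
   the degrees of the successive contracted vertices grow at most linearly. *)
Lemma twoconn_cliques_le (T : finType) (e : rel T) (V : {set T}) (k t j : nat) :
  symmetric e -> irreflexive e -> 3 < k -> 0 < t ->
  no_long_cycle e k V -> twoconn e V -> #|V| = k + j ->
  exists s, [/\ 1 < s, s.*2 < k, exists2 u, u \in V & deg e V u <= s + j &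
    #|cliques e t V| <= 'C(k - s, t) + s * 'C(s, t.-1) +
       \sum_(i < j) 'C(minn (s + i.+1) k.-1./2, t.-1)].
Proof.
move=> sym_e irr_e k3 t0; elim: j e sym_e irr_e V => [|j IH] e sym_e irr_e V nlc tw Vk.
  have kV : k <= #|V| by rewrite Vk addn0.
  have [S [SV S1 Sk dS]] := posa_vertices sym_e irr_e nlc tw kV k3.
  exists #|S|; split=> //.
    have [u uS] : exists u, u \in S by apply/set0Pn; rewrite -card_gt0 ltnW.
    by exists u; rewrite ?addn0 ?dS // (subsetP SV).
  rewrite big_ord0 addn0; apply: leq_trans (cliques_delset t0 dS) _.
  rewrite leq_add2r; apply: leq_trans (cliques_bin _ _ _) _.
  by rewrite cardsD (setIidPr SV) Vk addn0.
have kV : k <= #|V| by rewrite Vk leq_addr.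
have V3 : 2 < #|V| by apply: leq_trans kV; apply: ltnW.
have [v0 v0V] : exists v, v \in V by apply/set0Pn; rewrite -card_gt0 (leq_trans _ V3).
case: (@arg_minnP _ v0 (fun v => v \in V) (fun v => deg e V v) v0V) => v vV minv.
have [w [wV evw cvw]] := exists_contractible sym_e irr_e tw V3 vV.
have [] := IH (contract e v w) (contract_sym sym_e v w) (contract_irr e v w) (V :\ v).
- exact: no_long_contract.
- exact: twoconn_contract.
- by have := cardsD1 v V; rewrite vV Vk addnS => -[].
move=> s [s1 sk [u uV du] le].
have uV' : u \in V by move: uV; rewrite inE => /andP[].
(* [u] has degree at most [s + j] after the contraction, hence at most one more before it, and [v]
   has minimum degree. *)
have dv : deg e V v <= s + j.+1.
  apply: leq_trans (minv u uV') (leq_trans (deg_contract irr_e V v w u) _).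
  by rewrite addnS ltnS.
(* Posa's condition at the present stage, independent of the [s] found at the last one. *)
have dh : deg e V v <= k.-1./2.
  have [S [SV S1 Sk dS]] := posa_vertices sym_e irr_e nlc tw kV k3.
  have [z zS] : exists u, u \in S by apply/set0Pn; rewrite -card_gt0 ltnW.
  apply: leq_trans (minv z (subsetP SV _ zS)) (leq_trans (dS z zS) _).
  by move: Sk; clear; lia.
exists s; split=> //; first by exists v.
rewrite big_ord_recr /= addnA; apply: leq_trans (cliques_del e V v t0) _.
apply: leq_add; first exact: leq_trans (cliques_rel _ _ (sub_contract irr_e v w)) le.
by apply: leq_bin2l; rewrite leq_min dv.
Qed.

Lemma twoconn_cliques_lt (T : finType) (e : rel T) (V : {set T}) (k t : nat) :
  symmetric e -> irreflexive e -> 2 < t < k ->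
  no_long_cycle e k V -> twoconn e V -> k <= #|V| ->
  #|cliques e t V| < gmax (k - 2) t #|V|.-1.
Proof.
move=> sym_e irr_e /andP[t3 tk] nlc tw kV.
have k3 : 3 < k := leq_ltn_trans t3 tk.
have [s [s1 sk _ le]] := twoconn_cliques_le sym_e irr_e k3 (ltnW (ltnW t3)) nlc tw (esym (subnKC kV)).
apply: (leq_ltn_trans le).
have -> : #|V|.-1 = k.-1 + (#|V| - k) by move: kV k3; clear; lia.
by apply: degree_bound => //; move: sk; clear; lia.
Qed.

(** * The extremal block structure *)

Section Extremal.
Variables (T : finType) (e : rel T) (V : {set T}) (k t : nat).
Hypotheses (sym_e : symmetric e) (irr_e : irreflexive e).
Hypotheses (t3 : 2 < t) (tk : t < k) (nlc : no_long_cycle e k V).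
Implicit Types (B : {set T}) (F S : {set {set T}}).

Local Notation g := (gmax (k - 2) t).

Let kE : (k - 2).+1 = k.-1. Proof. by move: t3 tk; clear; lia. Qed.
Let tp : t <= (k - 2).+1. Proof. by move: t3 tk; clear; lia. Qed.

(** A missing edge at [x] leaves it at most [|B| - 2] neighbours, so fewer than [C(|B| - 1, t - 1)]
    cliques pass through [x], and Pascal's rule makes the total too small. *)
Lemma clique_of_card B : t <= #|B| -> 'C(#|B|, t) <= #|cliques e t B| -> clique e B.
Proof.
move=> tB full; apply/cliqueP => x y xB yB xy; apply: contraTT full => nxy.
rewrite -ltnNge; have t0 : 0 < t by apply: leq_trans t3.
apply: leq_ltn_trans (cliques_del e B x t0) _.
have cB := cardsD1 x B; rewrite xB add1n in cB.
have dx : deg e B x <= #|B :\ x|.-1.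
  have := cardsD1 y (B :\ x); rewrite !inE eq_sym xy yB add1n => ->.
  apply/subset_leq_card/subsetP => z; rewrite !inE => /andP[zB exz].
  rewrite zB andbT; apply/andP; split; first by apply: contraNneq nxy => <-.
  by apply: contraTneq exz => ->; rewrite irr_e.
have Bx0 : 0 < #|B :\ x| by apply/card_gt0P; exists y; rewrite !inE eq_sym xy.
have := cliques_bin e t (B :\ x); rewrite cB; move: #|B :\ x| cB dx Bx0 => b cB dx b0 le.
have -> : 'C(b.+1, t) = 'C(b, t) + 'C(b, t.-1) by rewrite -{1}(prednK t0) binS prednK.
rewrite -addnS; apply: leq_add => //.
apply: leq_ltn_trans (leq_bin2l _ dx) _; apply: ltn_bin2l.
  by move: t3 tB; rewrite cB; clear; lia.
by rewrite ltn_predL.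
Qed.

Lemma block_le B : B \subset V -> twoconn e B -> 0 < #|B| -> #|cliques e t B| <= g #|B|.-1.
Proof.
move=> BV tw B0; have [lt|le] := ltnP #|B| k; last first.
  apply/ltnW/twoconn_cliques_lt => //; first by rewrite t3.
  by move=> c cB; apply: nlc => x /cB/(subsetP BV).
rewrite gmax_small ?prednK //; first exact: cliques_bin.
by move: lt t3 tk; clear; lia.
Qed.

Definition full B := (#|B| == k.-1) && clique e B.

(** Either the block has at least [k] vertices and the 2-connected bound is strict, or it has
    exactly [k - 1] and misses an edge. *)
Lemma block_lt B : B \subset V -> twoconn e B -> ~~ full B -> k - 2 <= #|B|.-1 ->
  #|cliques e t B| < g #|B|.-1.
Proof.
move=> BV tw nf kB; have [lt|le] := ltnP #|B| k; last first.
  apply: twoconn_cliques_lt => //; first by rewrite t3.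
  by move=> c cB; apply: nlc => x /cB/(subsetP BV).
have BE : #|B| = k.-1 by move: lt kB t3 tk; clear; lia.
rewrite gmax_small //; last by rewrite BE; move: t3 tk; clear; lia.
rewrite prednK; last by rewrite BE -kE.
rewrite ltnNge; apply: contra nf => le; rewrite /full BE eqxx.
by apply: clique_of_card => //; rewrite BE -kE.
Qed.

Lemma cliques_blocks F :
  (forall A : {set T}, A \subset V -> 1 < #|A| -> clique e A -> exists2 B, B \in F & A \subset B) ->
  #|cliques e t V| <= \sum_(B in F) #|cliques e t B|.
Proof.
move=> cl; apply: leq_trans (_ : #|\bigcup_(B in F) cliques e t B| <= _); last first.
  elim/big_rec2: _ => [|B n S _ le]; first by rewrite cards0.
  by apply: leq_trans (leq_card_setU _ _) _; rewrite leq_add2l.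
apply/subset_leq_card/subsetP => A; rewrite inE => /and3P[AV At cA].
have [|B BF AB] := cl A AV _ cA; first by rewrite (eqP At) ltnW.
by apply/bigcupP; exists B; rewrite // inE AB At.
Qed.

Lemma hyperforest_card F : hyperforest F -> {in F, forall B, B \subset V} ->
  \sum_(B in F) #|B|.-1 <= #|V|.-1.
Proof.
move=> hF FV; have [->|F0] := eqVneq F set0; first by rewrite big_set0.
have := hF F (subxx F) F0; have : #|cover F| <= #|V|.
  by apply/subset_leq_card/bigcupsP.
by clear; lia.
Qed.

Lemma cliques_le : #|cliques e t V| <= g #|V|.-1.
Proof.
have [F [FB hF clF]] := exists_blocks e V.
apply: leq_trans (cliques_blocks clF) _.
apply: leq_trans (gmax_mono t3 tp (hyperforest_card hF _)); last by move=> B /FB[].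
apply: leq_trans (gmax_sum t3 tp _ _); apply: leq_sum => B /FB[BV B1 tw].
by apply: block_le => //; apply: ltnW.
Qed.

(* Merging parts never loses, and gains strictly when a multiple of [k - 2] is
   crossed; so non-full blocks of total weight at least [k - 2] are wasteful. *)
Lemma nonfull_sum (I : finType) (P : pred I) (c m : I -> nat) :
  (forall i, P i -> c i <= g (m i)) -> (forall i, P i -> k - 2 <= m i -> c i < g (m i)) ->
  \sum_(i | P i) c i <= g (\sum_(i | P i) m i) /\
  (k - 2 <= \sum_(i | P i) m i -> \sum_(i | P i) c i < g (\sum_(i | P i) m i)).
Proof.
move=> le lt.
elim/big_rec2: _ => [|i x y Pi [IHle IHlt]].
  by split=> // H; move: H t3 tk; clear; lia.
have l1 := le i Pi; have l2 := lt i Pi; have add := gmax_add t3 tp (m i) x.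
split=> [|mx]; first exact: leq_trans (leq_add l1 IHle) add.
have [mi|mi] := leqP (k - 2) (m i).
  by apply: leq_trans add; rewrite -addSn leq_add // l2.
have [xi|xi] := leqP (k - 2) x.
  by apply: leq_trans add; rewrite -addnS leq_add // IHlt.
exact: leq_ltn_trans (leq_add l1 IHle) (gmax_cross_lt t3 tp mi xi mx).
Qed.

Lemma extremal_blocks q r : #|V| = q * (k - 2) + r -> 0 < r <= k - 2 ->
  #|cliques e t V| = q * 'C(k.-1, t) + 'C(r, t) ->
  exists F : {set {set T}},
  [/\ {in F, forall B, [/\ B \subset V, 1 < #|B| & twoconn e B]},
      hyperforest F,
      forall A : {set T}, A \subset V -> 1 < #|A| -> clique e A -> exists2 B, B \in F & A \subset B,
      #|[set B in F | full B]| = q &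
      t <= r -> \sum_(B in F) #|B|.-1 = #|V|.-1 /\
        exists2 B0, [set B in F | ~~ full B] = [set B0] & #|B0| = r /\ clique e B0].
Proof.
move=> Vn /andP[r0 rk] eqV; have [F [FB hF clF]] := exists_blocks e V.
exists F; set Fu := [set B in F | full B]; set R := [set B in F | ~~ full B].
have RF B : B \in R -> [/\ B \in F, B \subset V, 1 < #|B|, twoconn e B & ~~ full B].
  by rewrite inE => /andP[BF nf]; have [] := FB B BF.
have splitF (f : {set T} -> nat) : \sum_(B in F) f B = \sum_(B in Fu) f B + \sum_(B in R) f B.
  rewrite (bigID full) /=; congr (_ + _); apply: eq_bigl => B; rewrite inE //.
have sumFu : \sum_(B in Fu) #|B|.-1 = #|Fu| * (k - 2).
  rewrite -sum_nat_const; apply: eq_bigr => B; rewrite inE => /and3P[_ /eqP -> _].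
  by move: t3 tk; clear; lia.
have sumFuc : \sum_(B in Fu) #|cliques e t B| <= #|Fu| * 'C(k.-1, t).
  rewrite -sum_nat_const; apply: leq_sum => B; rewrite inE => /and3P[_ /eqP <- _].
  exact: cliques_bin.
have RVn := hyperforest_card hF (fun B BF => let: And3 BV _ _ := FB B BF in BV).
have cF := cliques_blocks clF; rewrite !splitF sumFu in RVn cF.
have lR B : B \in R -> #|cliques e t B| <= g #|B|.-1.
  by move=> /RF[_ BV B1 tw _]; apply: block_le => //; apply: ltnW.
have [le1 lt1] := @nonfull_sum _ [in R] (fun B => #|cliques e t B|) (fun B => #|B|.-1) lR
  (fun B BR => let: And5 _ BV _ tw nf := RF B BR in block_lt BV tw nf).
rewrite /= in le1 lt1.
pose M := \sum_(B in R) #|B|.-1; rewrite -/M in RVn le1 lt1.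
have V1 : #|V|.-1 = q * (k - 2) + r.-1 by rewrite Vn -{1}(prednK r0) addnS.
have gV : g #|V|.-1 = q * 'C(k.-1, t) + 'C(r, t).
  rewrite V1 gmaxDp // kE gmax_small //; first by rewrite prednK.
  exact: leq_trans (leq_pred _) rk.
have gFu : g (#|Fu| * (k - 2) + M) = #|Fu| * 'C(k.-1, t) + g M by rewrite gmaxDp // kE.
have mono := gmax_mono t3 tp RVn; rewrite gV gFu in mono; rewrite eqV in cF.
(* The chain of upper bounds ends at the assumed value, so the blocks in [R] attain their joint
   bound. *)
have cR : \sum_(B in R) #|cliques e t B| = g M.
  apply/eqP; rewrite eqn_leq le1 -(leq_add2l (#|Fu| * 'C(k.-1, t))).
  by apply: leq_trans mono (leq_trans cF _); rewrite leq_add2r.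
have Mk : M < k - 2.
  by rewrite ltnNge; apply/negP => /lt1; rewrite cR ltnn.
have gM : g M = 'C(M.+1, t) by rewrite gmax_small // ltnW.
have eqC : #|Fu| * 'C(k.-1, t) + 'C(M.+1, t) = q * 'C(k.-1, t) + 'C(r, t).
  apply/eqP; rewrite -gM eqn_leq mono /=; apply: leq_trans cF _.
  by rewrite cR leq_add2r.
have small m : m < k.-1 -> 'C(m, t) < 'C(k.-1, t).
  by apply: ltn_bin2l; rewrite -kE tp andbT; apply: leq_trans t3.
have sM : 'C(M.+1, t) < 'C(k.-1, t) by apply: small; rewrite -kE ltnS.
have sr : 'C(r, t) < 'C(k.-1, t) by apply: small; rewrite -kE ltnS.
(* In [eqC] both remainders are below [C(k - 1, t)], so uniqueness of Euclidean division identifies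
   the quotients, and then the remainders. *)
have Fuq : #|Fu| = q.
  have C0 : 0 < 'C(k.-1, t) := leq_ltn_trans (leq0n _) sr.
  have := congr1 (divn^~ 'C(k.-1, t)) eqC; rewrite /= !divnMDl //.
  by rewrite !(@divn_small _ 'C(k.-1, t)) // !addn0.
split=> // tr; rewrite Fuq in eqC RVn; move/addnI: eqC => eqC.
(* For [t <= r] the equality [C(M + 1, t) = C(r, t)] pins [M] down, as the binomial increases
   strictly up to [r]. *)
have Mr : M = r.-1.
  apply/eqP; rewrite eqn_leq; apply/andP; split.
    by move: RVn; rewrite V1 leq_add2l.
  rewrite leqNgt; apply/negP => lt; have := @ltn_bin2l M.+1 r t.
  rewrite eqC ltnn tr andbT => H; suff : false by []; apply: H.
    exact: leq_trans t3.
  by move: lt r0; clear; lia.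
split; first by rewrite splitF sumFu Fuq V1 -/M Mr.
have [B0 B0R] : exists B, B \in R.
  apply/set0Pn; apply/eqP => R0; move: cR; rewrite R0 big_set0 gM eqC => /esym/eqP.
  by rewrite -leqn0 leqNgt bin_gt0 tr.
have cRB := cR; rewrite (big_setD1 B0) //= in cRB.
have MB : M = #|B0|.-1 + \sum_(B in R :\ B0) #|B|.-1 by rewrite /M (big_setD1 B0).
have m0 : 0 < #|B0|.-1 by have [_ _ B1 _ _] := RF B0 B0R; move: B1; clear; lia.
(* A second block would split the weight [r - 1] into two positive parts, a strict loss by
   [gmax_small_lt]. *)
have RB : R = [set B0].
  apply/eqP; rewrite eqEsubset sub1set B0R andbT; apply/subsetP => B1 B1R.
  rewrite inE; apply: contraT => B10.
  have B1R' : B1 \in R :\ B0 by rewrite in_setD1 B10.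
  have le2 : \sum_(B in R :\ B0) #|cliques e t B| <= g (\sum_(B in R :\ B0) #|B|.-1).
    apply: leq_trans (gmax_sum t3 tp _ _); apply: leq_sum => B.
    by rewrite in_setD1 => /andP[_ /lR].
  have m1 : 0 < \sum_(B in R :\ B0) #|B|.-1.
    rewrite (big_setD1 B1) //=; have [_ _ B11 _ _] := RF B1 B1R.
    by move: B11; clear; lia.
  have := @gmax_small_lt _ _ t3 tp #|B0|.-1 (\sum_(B in R :\ B0) #|B|.-1) m0 m1.
  rewrite -MB => H; have {}H : g #|B0|.-1 + g (\sum_(B in R :\ B0) #|B|.-1) < g M.
    by apply: H; [exact: ltnW | rewrite Mr prednK].
  by have := leq_ltn_trans (leq_add (lR B0 B0R) le2) H; rewrite cRB ltnn.
exists B0 => //; have cB0 : #|B0| = r.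
  move: MB; rewrite RB setDv big_set0 addn0 Mr; move: m0 r0; clear; lia.
split=> //; apply: clique_of_card; rewrite cB0 //.
by move: cR; rewrite RB big_set1 gM eqC => ->.
Qed.

End Extremal.

(** * From hyperforests to the auxiliary graph *)

Section Hyperforests.
Variables (T : finType) (l : nat) (E : 'I_l -> {set {set T}}) (F : {set {set T}}).
Hypotheses (hF : hyperforest F) (EF : forall i, cover (E i) \in F).
Hypothesis injE : injective (fun i => cover (E i)).
Local Notation B i := (cover (E i)).
Implicit Types (c : seq 'I_l) (i j : 'I_l).

Lemma hyperforest_indexed (S : {set 'I_l}) : S != set0 ->
  \sum_(i in S) #|B i|.-1 < #|\bigcup_(i in S) B i|.
Proof.
move=> S0; have injS : {in S &, injective (fun i => B i)} by move=> i j _ _; apply: injE.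
have := @hF [set B i | i in S].
rewrite (big_imset (fun A : {set T} => #|A|.-1) injS) /cover (big_imset id injS) /=.
apply; first by apply/subsetP => _ /imsetP[i _ ->]; exact: EF.
by case/set0Pn: S0 => i iS; apply/set0Pn; exists (B i); apply: imset_f.
Qed.

Lemma hyperforest_uniq c : uniq c -> c != [::] ->
  \sum_(i <- c) #|B i|.-1 < #|\bigcup_(i <- c) B i|.
Proof.
move=> uc c0; rewrite !(big_uniq _ uc) /=.
have -> : \sum_(i in c) #|B i|.-1 = \sum_(i in [set i in c]) #|B i|.-1.
  by apply: eq_bigl => i; rewrite inE.
have -> : \bigcup_(i in c) B i = \bigcup_(i in [set i in c]) B i.
  by apply: eq_bigl => i; rewrite inE.
apply: hyperforest_indexed; case: c {uc} c0 => // i c _.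
by apply/set0Pn; exists i; rewrite !inE eqxx.
Qed.

Lemma mem_bigcup_seq c (x : T) : (x \in \bigcup_(i <- c) B i) = has (fun i => x \in B i) c.
Proof. by elim: c => [|i c IH]; rewrite ?big_nil ?inE // big_cons inE IH. Qed.

Lemma hyperforest_gt0 i : 0 < #|B i|.
Proof.
have := @hyperforest_indexed [set i]; rewrite !big_set1 => H.
by apply: leq_ltn_trans (leq0n _) (H _); apply/set0Pn; exists i; rewrite inE.
Qed.

(** Each block shares a vertex with the next one, so it adds at most [|B| - 1] new vertices. This is
    the counterpart of the hyperforest inequality. *)
Lemma card_aux_path i c : path (aux_rel E) i c ->
  #|\bigcup_(j <- i :: c) B j| <= (\sum_(j <- i :: c) #|B j|.-1).+1.
Proof.
elim: c i => [|j c IH] i.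
  by move=> _; rewrite !big_seq1 prednK ?hyperforest_gt0.
move=> /= /andP[/andP[_ /set0Pn[x /setIP[xi xj]]] /IH le].
rewrite [in X in _ <= X]big_cons [in X in X <= _]big_cons cardsU.
have : 0 < #|B i :&: \bigcup_(j0 <- j :: c) B j0|.
  by apply/card_gt0P; exists x; rewrite inE xi mem_bigcup_seq /= xj.
have := hyperforest_gt0 i; move: le.
set a := \sum_(_ <- _) _; set b := #|\bigcup_(_ <- _) _|; set d := #|_ :&: _|.
by move: a b d; clear; lia.
Qed.

(* Otherwise the last step of the cycle would lose a second vertex. *)
Lemma aux_cycle_contact c i j j' x y : uniq c -> cycle (aux_rel E) c ->
  i \in c -> j \in c -> j' \in c -> j != i -> j' != i ->
  x \in B i -> x \in B j -> y \in B i -> y \in B j' -> x = y.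
Proof.
move=> uc cc ic jc j'c ji j'i xi xj yi yj'; apply/eqP; apply: contraT => xy.
have [m p rE] := rot_to ic.
have up : uniq (i :: p) by rewrite -rE rot_uniq.
have : cycle (aux_rel E) (i :: p) by rewrite -rE rot_cycle.
have jp : j \in p by move: jc; rewrite -(mem_rot m) rE inE (negPf ji).
have j'p : j' \in p by move: j'c; rewrite -(mem_rot m) rE inE (negPf j'i).
rewrite /cycle rcons_path => /andP[pp _].
have := hyperforest_uniq up isT; rewrite !big_cons cardsU.
have : 1 < #|B i :&: \bigcup_(j0 <- p) B j0|.
  apply/card_gt1P; exists x, y; split=> //; rewrite inE ?xi ?yi mem_bigcup_seq;
    apply/hasP; by [exists j | exists j'].
have : #|\bigcup_(j0 <- p) B j0| <= (\sum_(j0 <- p) #|B j0|.-1).+1.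
  case: p pp {up rE jp j'p} => [|j0 p] /=; first by rewrite !big_nil cards0.
  by move=> /andP[_]; apply: card_aux_path.
have := hyperforest_gt0 i.
set a := \sum_(_ <- _) _; set b := #|\bigcup_(_ <- _) _|; set d := #|_ :&: _|.
by move: a b d; clear; lia.
Qed.

(** Every block on a cycle meets its two neighbours in one and the same vertex by
    [aux_cycle_contact], so the first contact vertex is passed on to all blocks of the cycle. *)
Lemma hyperforest_aux_forest : aux_forest E.
Proof.
move=> c /and3P[c2 cc uc].
case: c c2 cc uc => [//|i0 [//|i1 [//|i2 c]]] _ cc uc; set s := i0 :: _ in cc uc *.
have : path (aux_rel E) i0 (rcons [:: i1, i2 & c] i0) := cc.
rewrite rcons_path => /andP[pp _].
have /pathP step := pp; have {}step n := step i0 n.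
have /andP[_ /set0Pn[v /setIP[v0 v1]]] := step 0 isT.
exists v.
have H n : n.+1 < size s -> v \in B (nth i0 s n) /\ v \in B (nth i0 s n.+1).
  elim: n => [//|n IH] lt; have [vn vn1] := IH (ltnW lt); split=> //.
  have /andP[_ /set0Pn[y /setIP[y1 y2]]] := step n.+1 lt.
  have neq a b : a < size s -> b < size s -> a != b -> nth i0 s a != nth i0 s b.
    by move=> la lb; rewrite nth_uniq.
  have l1 := ltnW lt; have l0 := ltnW l1.
  suff -> : v = y by exact: y2.
  apply: (aux_cycle_contact uc cc (i := nth i0 s n.+1) (j := nth i0 s n)
    (j' := nth i0 s n.+2)); rewrite ?mem_nth ?neq //.
    by rewrite neq_ltn ltnSn.
  by rewrite neq_ltn ltnSn orbT.
apply/(all_nthP i0) => [[|n]] ns; first exact: v0.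
by have [] := H n ns.
Qed.

(** Two groups of blocks without contact would have disjoint covers, each exceeding its weight, so
    together at least [|T| + 1] vertices. *)
Lemma hyperforest_aux_connected (i0 : 'I_l) : \sum_i #|B i|.-1 = #|T|.-1 -> sconnected (aux_graph E).
Proof.
move=> sumE; split; first by apply/card_gt0P; exists i0.
move=> i j; apply: contraT => nij.
pose S := [set m : 'I_l | connect (aux_rel E) i m].
have iS : i \in S by rewrite inE connect0.
have jS : j \in ~: S by rewrite !inE.
have h1 := @hyperforest_indexed S; have h2 := @hyperforest_indexed (~: S).
have {}h1 := h1 (introT (set0Pn S) (ex_intro _ i iS)).
have {}h2 := h2 (introT (set0Pn (~: S)) (ex_intro _ j jS)).
have dis : (\bigcup_(i in S) B i) :&: (\bigcup_(i in ~: S) B i) = set0.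
  apply/setP => x; rewrite in_setI in_set0; apply/negP => /andP[/bigcupP[a aS xa] /bigcupP[b bS xb]].
  move: bS; rewrite in_setC => /negP; apply; have [<-//|ab] := eqVneq a b.
  rewrite inE in aS; rewrite inE; apply: connect_trans aS (connect1 _); apply/andP; split=> //.
  by apply/set0Pn; exists x; rewrite inE xa.
have : #|(\bigcup_(i in S) B i) :|: (\bigcup_(i in ~: S) B i)| <= #|T| := max_card _.
rewrite cardsU dis cards0 subn0.
have : \sum_i #|B i|.-1 = \sum_(i in S) #|B i|.-1 + \sum_(i in ~: S) #|B i|.-1.
  by rewrite (bigID (mem S)) /=; congr (_ + _); apply: eq_bigl => m; rewrite ?in_setC.
rewrite sumE => E1 E2; have T0 : 0 < #|T| by apply: leq_trans E2; rewrite addn_gt0 (leq_ltn_trans _ h1).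
have := leq_trans (leq_add h1 h2) E2.
by rewrite addnS addSn -E1 prednK // ltnn.
Qed.

End Hyperforests.

Section Isomorphisms.
Implicit Types G H K : sgraph.

Lemma sgraph_iso_trans G H K : sgraph_iso G H -> sgraph_iso H K -> sgraph_iso G K.
Proof.
move=> [f bf mf] [g bg mg]; exists (g \o f); first exact: bij_comp.
by move=> x y /=; rewrite mg mf.
Qed.

Lemma sgraph_iso_sym G H : sgraph_iso G H -> sgraph_iso H G.
Proof.
move=> [f [f' ff' f'f] mf]; exists f'; first by exists f.
by move=> x y; rewrite -mf !f'f.
Qed.

Lemma sgraph_iso_complete G m : #|G| = m -> (forall x y : G, x != y -> sedge x y) ->
  sgraph_iso G (complete m).
Proof.
move=> Gm ed; pose f (x : G) : 'I_m := cast_ord Gm (enum_rank x).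
exists f; first by apply: inj_card_bij; [move=> x y /cast_ord_inj/enum_rank_inj | rewrite card_ord Gm].
move=> x y; rewrite [LHS]/= /complete_rel (inj_eq (@cast_ord_inj _ _ _)) (inj_eq enum_rank_inj).
by have [->|xy] := eqVneq x y; rewrite ?sedge_irrefl ?ed.
Qed.

End Isomorphisms.

Section InnerEdges.
Variable G : sgraph.
Implicit Types (A B : {set G}) (S F : {set {set G}}).
Local Notation e := (@sedge G).

Definition inner B : {set {set G}} := [set a in edges G | a \subset B].

Lemma edgesP a : reflect (exists x y, sedge x y /\ a = [set x; y]) (a \in edges G).
Proof.
rewrite inE; apply: (iffP existsP) => [[x /existsP[y /andP[xy /eqP ->]]]|[x [y [xy ->]]]].
  by exists x, y.
by exists x; apply/existsP; exists y; rewrite xy eqxx.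
Qed.

Lemma edge_set2 (x y : G) : ([set x; y] \in edges G) = sedge x y.
Proof.
apply/edgesP/idP => [[u [v [uv E]]]|xy]; last by exists x, y.
have xn : x \in [set u; v] by rewrite -E !inE eqxx.
have yn : y \in [set u; v] by rewrite -E !inE eqxx orbT.
have un : u \in [set x; y] by rewrite E !inE eqxx.
have vn : v \in [set x; y] by rewrite E !inE eqxx orbT.
have uv' : u != v by apply: contraTneq uv => ->; rewrite sedge_irrefl.
move: xn yn un vn uv'; rewrite !inE.
case/orP => /eqP xe; case/orP => /eqP ye; subst x y; rewrite ?eqxx ?orbT ?orbF //=.
- by rewrite orbb => _ /eqP ->; rewrite eqxx.
- by rewrite sedge_sym.
by rewrite orbb => /eqP ->; rewrite eqxx.
Qed.

Lemma card_edge a : a \in edges G -> #|a| = 2.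
Proof.
by move=> /edgesP[x [y [xy ->]]]; rewrite cards2; case: eqVneq xy => // ->; rewrite sedge_irrefl.
Qed.

Lemma cover_inner B : 1 < #|B| -> conn e B -> cover (inner B) = B.
Proof.
move=> B1 cB; apply/setP => x; apply/bigcupP/idP => [[a]|xB].
  by rewrite inE => /andP[_ /subsetP aB] /aB.
have [|||y [z [/set1P -> zB zx xz]]] := conn_exit cB (A := [set x]).
- by rewrite sub1set.
- by apply/set0Pn; exists x; rewrite inE.
- by apply: contraTneq B1 => <-; rewrite cards1.
exists [set x; z]; last by rewrite !inE eqxx.
by rewrite inE edge_set2 xz subUset !sub1set xB.
Qed.

Lemma iso_inner_complete B m : 1 < #|B| -> conn e B -> clique e B -> #|B| = m ->
  sgraph_iso (edge_graph (inner B)) (complete m).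
Proof.
move=> B1 cB /cliqueP clB Bm; have cE := cover_inner B1 cB; apply: sgraph_iso_complete.
  by rewrite card_sig -Bm -{2}cE; apply: eq_card.
move=> x y xy; rewrite /= /edge_graph_rel xy inE /=.
have inB z : z \in cover (inner B) -> z \in B by rewrite cE.
have xB := inB _ (valP x); have yB := inB _ (valP y).
by rewrite edge_set2 clB // subUset !sub1set xB.
Qed.

(* [s] lists the blocks in the order of [Fs]. *)
Lemma exists_block_decomposition F (s : seq {set G}) (Fs : seq sgraph) :
  hyperforest F -> {in F, forall B, 1 < #|B| /\ conn e B} ->
  (forall A : {set G}, 1 < #|A| -> clique e A -> exists2 B, B \in F & A \subset B) ->
  uniq s -> s =i F -> size s = size Fs ->
  (forall i, i < size s ->
     sgraph_iso (edge_graph (inner (nth set0 s i))) (nth (complete 0) Fs i)) ->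
  exists E, [/\ @block_decomposition G Fs E, aux_forest E &
    0 < size Fs -> \sum_(B in F) #|B|.-1 = #|G|.-1 -> sconnected (aux_graph E)].
Proof.
move=> hF FB clF us sF szs isos.
pose E (i : 'I_(size Fs)) := inner (nth set0 s i).
have iF (i : 'I_(size Fs)) : nth set0 s i \in F by rewrite -sF mem_nth // szs.
have cE i : cover (E i) = nth set0 s i.
  by have [B1 cB] := FB _ (iF i); apply: cover_inner.
have EF i : cover (E i) \in F by rewrite cE.
have injE : injective (fun i => cover (E i)).
  move=> i j /eqP; rewrite !cE nth_uniq ?szs // => /eqP; exact: val_inj.
(* The hyperforest inequality for a subfamily of two blocks. *)
have meet (i j : 'I_(size Fs)) : i != j -> #|cover (E i) :&: cover (E j)| <= 1.
  move=> ij; have := @hyperforest_indexed _ _ _ _ hF EF injE [set i; j].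
  have h0 := hyperforest_gt0 hF EF injE.
  rewrite !big_setU1 ?inE //= !big_set1 cardsU => H.
  have := H (introT (set0Pn _) (ex_intro _ i (setU11 _ _))).
  have := h0 i; have := h0 j.
  set a := #|cover _|; set b := #|cover _|; set d := #|_ :&: _|.
  have : d <= a by apply: subset_leq_card; apply: subsetIr.
  by move: a b d; clear; lia.
exists E; split.
- split=> [|i j ij|i|//].
  + apply/setP => a; apply/bigcupP/idP => [[i _]|ae]; first by rewrite inE => /andP[].
    (* An edge is a clique with two vertices, so some block contains it. *)
    have [x [y [xy aE]]] := elimT (edgesP a) ae.
    have [||B BF aB] := clF a; first by rewrite (card_edge ae).
      apply/cliqueP => u v; rewrite aE !inE => /orP[]/eqP-> /orP[]/eqP->; rewrite ?eqxx // => _.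
      by rewrite sedge_sym.
    have Bs : B \in s by rewrite sF.
    have Bi : index B s < size Fs by rewrite -szs index_mem.
    by exists (Ordinal Bi) => //; rewrite inE ae /= nth_index.
  + rewrite -setI_eq0; apply/eqP/setP => a; rewrite in_set0; apply/negP.
    rewrite !inE => /andP[/andP[ae ai] /andP[_ aj]].
    have := meet i j ij; rewrite leqNgt => /negP; apply.
    rewrite -(card_edge (a := a)); last by rewrite inE.
    by apply/subset_leq_card; rewrite !cE subsetI ai.
  by apply: isos; rewrite szs.
- exact: hyperforest_aux_forest hF EF injE.
move=> l0 sumF; apply: (hyperforest_aux_connected hF EF injE (Ordinal l0)).
rewrite -sumF -(eq_bigl _ _ sF) -(big_uniq _ us) /= (big_nth set0) big_mkord szs.
by apply: eq_bigr => i _; rewrite cE.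
Qed.

(** The lower bound for the converse directions. Blocks share at most one vertex and [t > 1], so no
    clique is counted twice; the weight [w] may be set to 0 at blocks of unknown shape. *)
Lemma block_decomposition_cliques (Fs : seq sgraph) (E : 'I_(size Fs) -> {set {set G}})
    (t : nat) (w : nat -> nat) :
  1 < t -> block_decomposition E ->
  (forall i, i < size Fs -> w i != 0 ->
     exists2 m, sgraph_iso (nth (complete 0) Fs i) (complete m) & w i = 'C(m, t)) ->
  \sum_(i < size Fs) w i <= #|cliques e t [set: G]|.
Proof.
move=> t1 [unE _ isoE meetE] wE.
apply: leq_trans (_ : \sum_i #|cliques e t (cover (E i))| <= _).
  apply: leq_sum => i _; have [->//|w0] := eqVneq (w i) 0.
  have [m isom ->] := wE i (ltn_ord i) w0.
  have [f bf mf] := sgraph_iso_trans (isoE i) isom.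
  have cm : #|cover (E i)| = m.
    have := bij_eq_card bf; rewrite card_ord card_sig => <-.
    by apply: eq_card.
  have cl : clique e (cover (E i)).
    apply/cliqueP => x y xE yE xy; rewrite -edge_set2 -unE.
    apply/bigcupP; exists i => //.
    have := mf (exist _ x xE) (exist _ y yE); rewrite /= /complete_rel (bij_eq bf).
    rewrite /edge_graph_rel -val_eqE /= xy /= => /esym //.
  rewrite -cm -cards_draws; apply/subset_leq_card/subsetP => A.
  by rewrite !inE => /andP[AE ->]; rewrite AE (cliqueS AE cl).
rewrite -[X in _ <= X]sum1_card.
under eq_bigr do rewrite -sum1_card.
rewrite -partition_disjoint_bigcup => [|i j ij].
  rewrite !sum1_card; apply/subset_leq_card/bigcupsP => i _.
  by apply/subsetP => A; rewrite !inE subsetT => /and3P[_ -> ->].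
rewrite -setI_eq0; apply/eqP/setP => A; rewrite in_set0; apply/negP.
rewrite !inE => /andP[/and3P[Ai /eqP tA _] /and3P[Aj _ _]].
have := leq_trans (subset_leq_card (introT subsetIP (conj Ai Aj))) (meetE i j ij).
by rewrite tA leqNgt t1.
Qed.

End InnerEdges.

Section CountingCliques.
Implicit Types G H : sgraph.

Lemma num_cliquesE t G : num_cliques t G = #|cliques (@sedge G) t [set: G]|.
Proof. by congr #|pred_of_set _|; apply/setP => A; rewrite !inE subsetT. Qed.

Lemma num_cliques_complete t m : num_cliques t (complete m) = 'C(m, t).
Proof.
rewrite num_cliquesE -[in RHS](card_ord m) -cardsT -cards_draws.
congr #|pred_of_set _|; apply/setP => A; rewrite !inE; case: eqP => //= _; rewrite andbT.
rewrite subsetT; apply/cliqueP => x y _ _; exact.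
Qed.

(** A nonempty clique lies on one side; for [t = 0] the empty clique would be counted twice. *)
Lemma num_cliques_dunion t G H : 0 < t ->
  num_cliques t (dunion G H) = num_cliques t G + num_cliques t H.
Proof.
move=> t0; rewrite !num_cliquesE.
have il : injective (inl : G -> G + H) by move=> x y [].
have ir : injective (inr : H -> G + H) by move=> x y [].
rewrite -(card_imset _ (imset_inj il)) -(card_imset _ (imset_inj ir)).
set L := imset _ _; set R := imset _ _.
have LR : L :&: R = set0.
  apply/setP => A; rewrite !inE; apply/negP => /andP[/imsetP[B BL ->] /imsetP[C CR]].
  have [x xB] : exists x, x \in B.
    by apply/card_gt0P; move: BL; rewrite inE => /and3P[_ /eqP -> _].
  move/setP/(_ (inl x)); rewrite imset_f // => /esym/imsetP[y _]; discriminate.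
rewrite -[RHS]subn0 -(cards0 {set (G + H)%type}) -LR -cardsU.
congr #|pred_of_set _|; apply/setP => A; rewrite [RHS]inE; apply/idP/orP.
  rewrite inE subsetT /= => /andP[/eqP tA /cliqueP cA].
  have : 0 < #|A| by rewrite tA.
  case/card_gt0P => -[x|y] zA; [left|right].
    have AE : A = inl @: (inl @^-1: A).
      apply/setP => -[u|v]; first by rewrite mem_imset // inE.
      transitivity false; last by apply/esym/imsetP => -[].
      by apply/negP => /(cA _ _ zA)/(_ isT).
    apply/imsetP; exists (inl @^-1: A) => //; rewrite inE subsetT.
    rewrite -(card_imset _ il) -AE tA eqxx; apply/cliqueP => u v; rewrite !inE => uA vA uv.
    exact: (cA _ _ uA vA).
  have AE : A = inr @: (inr @^-1: A).
    apply/setP => -[u|v]; last by rewrite mem_imset // inE.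
    transitivity false; last by apply/esym/imsetP => -[].
    by apply/negP => /(cA _ _ zA)/(_ isT).
  apply/imsetP; exists (inr @^-1: A) => //; rewrite inE subsetT.
  rewrite -(card_imset _ ir) -AE tA eqxx; apply/cliqueP => u v; rewrite !inE => uA vA uv.
  exact: (cA _ _ uA vA).
case=> /imsetP[B]; rewrite inE => /and3P[_ tB /cliqueP cB] ->; rewrite inE subsetT.
  rewrite card_imset // tB; apply/cliqueP => _ _ /imsetP[u uB ->] /imsetP[v vB ->] uv.
  by apply: cB => //; apply: contraNneq uv => ->.
rewrite card_imset // tB; apply/cliqueP => _ _ /imsetP[u uB ->] /imsetP[v vB ->] uv.
by apply: cB => //; apply: contraNneq uv => ->.
Qed.

Lemma num_cliques_iter t q m r : 0 < t ->
  num_cliques t (iter q (dunion (complete m)) (complete r)) = q * 'C(m, t) + 'C(r, t).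
Proof.
move=> t0; elim: q => [|q IH]; first by rewrite num_cliques_complete.
by rewrite iterS num_cliques_dunion // IH num_cliques_complete mulSn addnA.
Qed.

End CountingCliques.

(** The only component is an induced subgraph on a subtype, so it is isomorphic to the complete
    graph without being the same term. *)
Lemma components_complete m : 0 < m ->
  exists2 X, components (complete m) = [:: X] & sgraph_iso X (complete m).
Proof.
move=> m0; exists (induced [set: complete m]).
  rewrite /components (_ : equivalence_partition _ _ = [set [set: complete m]]) ?enum_set1 //.
  have conn_all (x y : complete m) : connect (@sedge (complete m)) x y.
    by have [->|xy] := eqVneq x y; rewrite ?connect0 // connect1.
  have cls (x : complete m) : [set y in [set: complete m] | connect (@sedge (complete m)) x y] = setT.
    by apply/setP => y; rewrite !inE conn_all.
  apply/setP => C; rewrite in_set1; apply/imsetP/eqP => [[x _ ->]|->]; first exact: cls.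
  by exists (Ordinal m0 : complete m); rewrite ?inE ?cls.
apply: sgraph_iso_complete; first by rewrite card_sig -[RHS]card_ord; apply: eq_card => x; rewrite !inE.
by move=> x y xy; rewrite /= /induced_rel /= /complete_rel val_eqE.
Qed.

(** * The disjoint union of prescribed blocks *)

Section DisjointBlocks.
Variables (G : sgraph) (R : {set {set G}}).
Hypothesis RB : {in R, forall B : {set G}, 1 < #|B| /\ conn (@sedge G) B}.
Implicit Types (B : {set G}).
Local Notation e := (@sedge G).

(** A vertex is tagged with its block, so blocks that share a vertex in [G] become separate
    components. The resulting graph is the witness [L] in [G_prime]. *)
Definition blocks_vertex := {z : {set G} * G | (z.1 \in R) && (z.2 \in z.1)}.

Definition blocks_rel : rel blocks_vertex :=
  fun u v => ((val u).1 == (val v).1) && e (val u).2 (val v).2.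

Fact blocks_sym : symmetric blocks_rel.
Proof. by move=> u v; rewrite /blocks_rel eq_sym sedge_sym. Qed.

Fact blocks_irrefl : irreflexive blocks_rel.
Proof. by move=> u; rewrite /blocks_rel sedge_irrefl andbF. Qed.

Definition blocks_graph : sgraph := SGraph blocks_sym blocks_irrefl.

Definition fiber B : {set blocks_graph} := [set z : blocks_graph | (val z).1 == B].

Definition block_of (C : {set blocks_graph}) : {set G} := [set (val z).2 | z in C].

Lemma block_of_fiber B : B \in R -> block_of (fiber B) = B.
Proof.
move=> BR; apply/setP => x; apply/imsetP/idP => [[z]|xB].
  by rewrite inE => /eqP zB ->; have /andP[_] := valP z; rewrite zB.
have p : ((B, x).1 \in R) && ((B, x).2 \in (B, x).1) by rewrite BR xB.
by exists (exist _ (B, x) p : blocks_vertex); rewrite ?inE /=.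
Qed.

Lemma blocks_connect (u v : blocks_graph) :
  connect (@sedge blocks_graph) u v = ((val u).1 == (val v).1).
Proof.
apply/idP/idP => [uv|/eqP uv].
  have : v \in fiber (val u).1.
    apply: connect_closed uv; last by rewrite inE.
    by move=> a; rewrite inE => /eqP <- b /andP[/eqP ab _]; rewrite inE ab.
  by rewrite inE eq_sym.
have /andP[uR uB] := valP u; have /andP[_ vB] := valP v; rewrite -uv in vB.
(* The default [u] is only returned outside the block; inside it [f x] is the tagged copy of [x]. *)
have [_ cB] := RB uR; pose f x : blocks_graph := insubd (u : blocks_vertex) ((val u).1, x).
have fE x : x \in (val u).1 -> val (f x) = ((val u).1, x).
  by move=> xB; rewrite val_insubd /= uR xB.
have -> : u = f (val u).2 by apply: val_inj; rewrite fE // -surjective_pairing.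
have -> : v = f (val v).2 by apply: val_inj; rewrite fE // uv -surjective_pairing.
apply: connect_hom (cB _ _ uB vB) => x y /and3P[xB yB xy].
by apply: connect1; rewrite /= /blocks_rel !fE //= eqxx.
Qed.

Lemma blocks_partition :
  equivalence_partition (connect (@sedge blocks_graph)) [set: blocks_graph] =
  [set fiber B | B in R].
Proof.
have cls (u : blocks_graph) :
    [set v in [set: blocks_graph] | connect (@sedge blocks_graph) u v] = fiber (val u).1.
  by apply/setP => v; rewrite !inE blocks_connect eq_sym.
apply/setP => C; apply/imsetP/imsetP => [[u _ ->]|[B BR ->]].
  by exists (val u).1; [have /andP[] := valP u | exact: cls].
have [x xB] : exists x, x \in B by apply/card_gt0P/ltnW; have [] := RB BR.
have p : ((B, x).1 \in R) && ((B, x).2 \in (B, x).1) by rewrite BR xB.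
by exists (exist _ (B, x) p : blocks_vertex) => //; rewrite cls.
Qed.

Lemma iso_inner_fiber B : B \in R -> sgraph_iso (edge_graph (inner B)) (induced (fiber B)).
Proof.
move=> BR; have [B1 cB] := RB BR; have cE := cover_inner B1 cB.
have p1 x : x \in cover (inner B) -> ((B, x).1 \in R) && ((B, x).2 \in (B, x).1).
  by rewrite cE /= BR.
pose f1 (x : edge_graph (inner B)) : blocks_graph := exist _ (B, val x) (p1 _ (valP x)).
have p2 x : f1 x \in fiber B by rewrite inE.
pose f (x : edge_graph (inner B)) : induced (fiber B) := exist _ (f1 x) (p2 x).
have fibE (z : blocks_graph) : z \in fiber B -> (val z).1 = B /\ (val z).2 \in B.
  by rewrite inE => /eqP zB; have /andP[_] := valP z; rewrite zB.
have q (u : induced (fiber B)) : (val (val u)).2 \in cover (inner B).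
  by rewrite cE; exact: (fibE _ (valP u)).2.
pose h (u : induced (fiber B)) : edge_graph (inner B) := exist _ (val (val u)).2 (q u).
exists f.
  exists h => [x|u]; apply: val_inj => //; apply: val_inj.
  have [uB _] := fibE _ (valP u).
  by transitivity (B, (val (val u)).2) => //; rewrite [RHS]surjective_pairing uB.
move=> x y; rewrite /= /induced_rel /= /blocks_rel /= eqxx /= /edge_graph_rel.
have inB z : z \in cover (inner B) -> z \in B by rewrite cE.
rewrite inE edge_set2 subUset !sub1set !inB ?(valP x) ?(valP y) // !andbT.
rewrite andb_idl // => xy; apply: contraTneq xy => ->; by rewrite sedge_irrefl.
Qed.

(** [components] lists the fibers in the order of their enumeration; [s] carries this order back to
    the blocks of [G]. *)
Lemma components_blocks_graph : exists2 s : seq {set G},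
  [/\ uniq s, s =i R & size s = size (components blocks_graph)] &
  forall i, i < size s ->
    sgraph_iso (edge_graph (inner (nth set0 s i))) (nth (complete 0) (components blocks_graph) i).
Proof.
rewrite /components blocks_partition; set P := [set fiber B | B in R].
exists [seq block_of C | C <- enum P].
  split; last by rewrite !size_map.
    rewrite map_inj_in_uniq ?enum_uniq // => C D.
    rewrite !mem_enum => /imsetP[B BR ->] /imsetP[B' BR' ->].
    by rewrite !block_of_fiber // => ->.
  move=> B; apply/mapP/idP => [[C]|BR].
    by rewrite mem_enum => /imsetP[B' BR' ->] ->; rewrite block_of_fiber.
  by exists (fiber B); rewrite ?block_of_fiber // mem_enum imset_f.
move=> i; rewrite size_map => iP; rewrite !(nth_map set0) //.
have : nth set0 (enum P) i \in P by rewrite -mem_enum mem_nth.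
move=> /imsetP[B BR ->]; rewrite block_of_fiber //.
exact: iso_inner_fiber.
Qed.

End DisjointBlocks.

Lemma flatten_components_nseq q (K X L : sgraph) : components K = [:: X] ->
  flatten [seq components F | F <- rcons (nseq q K) L] = nseq q X ++ components L.
Proof.
move=> KX; rewrite map_rcons map_nseq KX -cats1 flatten_cat /= cats0.
by congr cat; elim: q => //= q ->.
Qed.

Theorem theorem1p7 (n t k q r : nat) (G : sgraph) :
  0 < n -> 3 <= t < k -> n = q * (k - 2) + r -> 1 <= r <= k - 2 ->
  #|G| = n ->
  (forall c : seq G, is_cycle c -> size c < k) ->
  let U := iter q (dunion (complete k.-1)) (complete r) in
  [/\ num_cliques t G <= num_cliques t U,
      num_cliques t U = q * 'C(k.-1, t) + 'C(r, t),
      t <= r -> (num_cliques t G = num_cliques t U <->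
                 G_tree (rcons (nseq q (complete k.-1)) (complete r)) G) &
      r < t -> (num_cliques t G = num_cliques t U <-> G_prime n q k G)].
Proof.
move=> n0 /andP[t3 tk] nE rk Gn nlcG U.
have [r0 rk2] := andP rk.
have t0 : 0 < t by apply: ltnW (ltnW t3).
have k1 : 0 < k.-1 by move: t3 tk; clear; lia.
have nlc : no_long_cycle (@sedge G) k [set: G].
  by move=> c _ c2 cc uc; apply: nlcG; rewrite /is_cycle c2 cc.
have UE : num_cliques t U = q * 'C(k.-1, t) + 'C(r, t) by apply: num_cliques_iter.
have GT : #|[set: G]| = q * (k - 2) + r by rewrite cardsT Gn.
have ub : #|cliques (@sedge G) t [set: G]| <= q * 'C(k.-1, t) + 'C(r, t).
  apply: leq_trans (cliques_le (@sedge_sym G) (@sedge_irrefl G) t3 tk nlc) _.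
  rewrite GT -{1}(prednK r0) addnS /= gmaxDp // ?gmax_small ?prednK //.
  - by have -> : (k - 2).+1 = k.-1 by move: t3 tk; clear; lia.
  - by move: t3 tk; clear; lia.
  - exact: leq_trans (leq_pred _) rk2.
  by move: t3 tk; clear; lia.
have structure := extremal_blocks (@sedge_sym G) (@sedge_irrefl G) t3 tk nlc GT rk.
rewrite UE num_cliquesE; split=> //.
  move=> tr; split.
    move=> /structure[F [FB hF clF Fuq /(_ tr)[sumF [B0 RB0 [B0r B0c]]]]].
    have FB' : {in F, forall B : {set G}, 1 < #|B| /\ conn (@sedge G) B}.
      move=> B /FB[_ B1 /(_ set0)]; rewrite cards0 setD0 => cB; split=> //; exact: cB.
    have B0F : (B0 \in F) && ~~ full (@sedge G) k B0.
      by have := set11 B0; rewrite -RB0 inE.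
    pose Fu := [set B in F | full (@sedge G) k B].
    have szFu : size (enum Fu) = q by rewrite -cardE.
    have [|||||E [dE fE cE]] := @exists_block_decomposition G F (rcons (enum Fu) B0)
        (rcons (nseq q (complete k.-1)) (complete r)) hF FB'.
    - by move=> A A1 cA; apply: clF.
    - by rewrite rcons_uniq enum_uniq mem_enum inE negb_and (andP B0F).2 orbT.
    - move=> B; rewrite mem_rcons inE mem_enum inE.
      have : (B \in [set B in F | ~~ full (@sedge G) k B]) = (B == B0) by rewrite RB0 inE.
      by rewrite inE => <-; case: (B \in F) => //=; case: full.
    - by rewrite !size_rcons szFu size_nseq.
    - move=> i; rewrite size_rcons ltnS szFu => iq; rewrite !nth_rcons szFu size_nseq.
      case: ltnP => [lt|le].
        have := mem_nth set0 (_ : i < size (enum Fu)); rewrite szFu => /(_ lt).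
        rewrite mem_enum inE => /and3P[/FB'[B1 cB] /eqP Bk Bc].
        by rewrite nth_nseq lt; apply: iso_inner_complete.
      have -> : i == q by rewrite eqn_leq iq.
      by have [B1 cB] := FB' _ (andP B0F).1; apply: iso_inner_complete.
    exists E => //; split=> //; apply: cE; first by rewrite size_rcons.
    by rewrite sumF cardsT.
  (* Conversely, the blocks of the decomposition already supply the extremal number of cliques; the
     upper bound is [ub]. *)
  move=> [E dE _]; apply/eqP; rewrite eqn_leq ub /=.
  have := @block_decomposition_cliques G _ E t (fun i => if i < q then 'C(k.-1, t) else 'C(r, t)) _ dE.
  rewrite size_rcons size_nseq big_ord_recr /= ltnn.
  under eq_bigr => i _ do rewrite ltn_ord.
  rewrite sum_nat_const card_ord; apply; first exact: ltnW.
  move=> i iq _; rewrite nth_rcons size_nseq nth_nseq; case: ltnP => [lt|le].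
    by exists k.-1 => //; exists id => //; exists id.
  have -> : i == q by rewrite eqn_leq le -ltnS iq.
  by exists r => //; exists id => //; exists id.
move=> rt; have [X XE Xiso] := components_complete k1; rewrite (bin_small rt) addn0 in ub structure *.
split.
  move=> /structure[F [FB hF clF Fuq _]]; split=> //.
  have FB' : {in F, forall B : {set G}, 1 < #|B| /\ conn (@sedge G) B}.
    move=> B /FB[_ B1 /(_ set0)]; rewrite cards0 setD0 => cB; split=> //; exact: cB.
  pose Fu := [set B in F | full (@sedge G) k B].
  pose R := [set B in F | ~~ full (@sedge G) k B].
  have RB : {in R, forall B : {set G}, 1 < #|B| /\ conn (@sedge G) B}.
    by move=> B; rewrite inE => /andP[/FB'].
  have szFu : size (enum Fu) = q by rewrite -cardE.
  have [s [us sR szs] isos] := components_blocks_graph RB.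
  (* [L] is the disjoint union of all blocks other than the copies of [K_(k-1)]. *)
  exists (blocks_graph R); rewrite /G_forest (flatten_components_nseq _ _ XE).
  have [|||||E [dE fE _]] := @exists_block_decomposition G F (enum Fu ++ s)
      (nseq q X ++ components (blocks_graph R)) hF FB'.
  - by move=> A A1 cA; apply: clF.
  - rewrite cat_uniq enum_uniq us andbT /=; apply/hasPn => B.
    by rewrite sR mem_enum !inE => /andP[-> ->].
  - by move=> B; rewrite mem_cat mem_enum sR !inE -andb_orr orbN andbT.
  - by rewrite !size_cat szFu size_nseq szs.
  - move=> i; rewrite size_cat szFu => iq; rewrite !nth_cat szFu size_nseq.
    case: ltnP => [lt|le].
      have := mem_nth set0 (_ : i < size (enum Fu)); rewrite szFu => /(_ lt).
      rewrite mem_enum inE => /and3P[/FB'[B1 cB] /eqP Bk Bc].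
      rewrite nth_nseq lt; apply: sgraph_iso_trans (sgraph_iso_sym Xiso).
      exact: iso_inner_complete.
    by apply: isos; rewrite ltn_subLR.
  by exists E.
move=> [_ [L]]; rewrite /G_forest (flatten_components_nseq _ _ XE) => -[E dE _].
apply/eqP; rewrite eqn_leq ub /=.
(* Components of [L] get weight 0: since [C(r, t) = 0], the [q] complete blocks alone reach the
   bound. *)
have := @block_decomposition_cliques G _ E t (fun i => if i < q then 'C(k.-1, t) else 0) _ dE.
rewrite size_cat size_nseq big_split_ord /=.
under eq_bigr => i _ do rewrite ltn_ord.
rewrite sum_nat_const card_ord => H; apply: leq_trans (leq_addr _ _) (H _ _).
  exact: ltnW.
move=> i _; case: ltnP => // lt _; exists k.-1 => //.
by rewrite nth_cat size_nseq lt nth_nseq lt.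
Qed.
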